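(* Let $A$ be a finite alphabet and $\{F_a:a\in A\}$ a Möbius iterative system. Let $\mathcal{W}=\{W_a:a\in A\}$ be an interval almost cover and $\Sigma\subseteq A^\omega$ a subshift compatible with $\mathcal{W}$ such that for some $n\ge1$ either $Q_n(\mathcal{W},\Sigma)>1$, or $Q_n(\mathcal{W},\Sigma)=1$ and no $F_v$ with $v\in\mathcal{L}(\Sigma_{\mathcal{W}})\cap A^n$ is a rotation. Then $\Sigma_{\mathcal{W}}$ is a Möbius number system for the iterative system $\{F_a:a\in A\}$. Moreover, $\Phi([v]\cap\Sigma_{\mathcal{W}})=\overline{W_v}$ for all $v\in A^*$.
   Context: $\mathbb{T}$ is the unit circle in $\mathbb{C}$. A disc preserving Möbius transformation is a map $F(z)=\frac{\alpha z+\beta}{\overline\beta z+\overline\alpha}$ with $|\alpha|^2-|\beta|^2=1$; it is a rotation if $\beta=0$, i.e. $F(z)=e^{i\phi}z$ (the identity is a rotation). Put $F^{\bullet}(x)=|F'(x)|$. Words: $A^*$ is the set of finite words over $A$ (including the empty word $\lambda$), $A^n$ the words of length $n$, $A^\omega$ the set of one-sided infinite words with the product topology; $w_{[0,n)}=w_0\cdots w_{n-1}$; $[v]$ is the set of $w\in A^\omega$ having $v$ as a prefix. A subshift is a closed set $\Sigma\subseteq A^\omega$ with $\sigma(\Sigma)\subseteq\Sigma$, where $\sigma(w)_i=w_{i+1}$. $\mathcal{L}(\Sigma)$ is the set of all finite words that are factors of some $w\in\Sigma$. A Möbius iterative system is a family $\{F_a:a\in A\}$ of disc preserving Möbius transformations.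 For $v=v_0\cdots v_{n-1}$ put $F_v=F_{v_0}\circ\cdots\circ F_{v_{n-1}}$ ($F_\lambda=\mathrm{id}$). A sequence $\{G_n\}$ of disc preserving Möbius transformations represents $x\in\mathbb{T}$ if $G_n\mu\to\delta_x$ weakly$^*$, where $\mu$ is the uniform probability measure on $\mathbb{T}$, $\delta_x$ is the Dirac measure at $x$ and $G\mu(E)=\mu(G^{-1}(E))$. For $w\in A^\omega$, $\Phi(w)$ is the point $x\in\mathbb{T}$ represented by $\{F_{w_{[0,n)}}\}_{n=1}^\infty$ if it exists, and is undefined otherwise. A subshift $\Sigma'\subseteq A^\omega$ is a Möbius number system for $\{F_a\}$ if $\Phi$ is defined on all of $\Sigma'$, $\Phi(\Sigma')=\mathbb{T}$ and $\Phi|_{\Sigma'}$ is continuous. An interval almost cover is a family $\mathcal{W}=\{W_a:a\in A\}$ where each $W_a$ is a union of finitely many (possibly zero) open intervals on $\mathbb{T}$ and $\bigcup_{a\in A}\overline{W_a}=\mathbb{T}$. Refined sets: $W_\lambda=\mathbb{T}$ and $W_u=W_{u_0}\cap F_{u_0}(W_{u_1})\cap\cdots\cap F_{u_{[0,n-1)}}(W_{u_{n-1}})$ for $u$ of length $n\geq1$. A nonempty subshift $\Sigma$ is compatible with $\mathcal{W}$ if for every $v\in\mathcal{L}(\Sigma)$, $\overline{W_v}=\bigcup_{a\in A,\,va\in\mathcal{L}(\Sigma)}\overline{W_{va}}$. The interval shift is $\Sigma_{\mathcal{W}}=\{w\in\Sigma:\forall n,\ W_{w_{[0,n)}}\ne\emptyset\}$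 (a subshift). Finally $q(u)=\min\{(F_u^{-1})^{\bullet}(x):x\in\overline{W_u}\}$ and $Q_n(\mathcal{W},\Sigma)=\min\{q(u):u\in\mathcal{L}(\Sigma_{\mathcal{W}}),\,|u|=n\}$.
   Formalization: The ''moreover'' is stated for all words v in L(Σ) instead of all v in A^*: for v outside L(Σ) the set [v]∩Σ_W is empty while W_v may be nonempty (e.g. a duplicated letter not used in Σ), so the equality can fail there. *)

(* Defs.v *)
From HB Require Import structures.
From mathcomp Require Import all_boot all_order all_algebra.
From mathcomp Require Import all_classical all_reals all_analysis.
From mathcomp Require Import complex ring.

Set Implicit Arguments.
Unset Strict Implicit.
Unset Printing Implicit Defensive.

Import Order.TTheory GRing.Theory Num.Theory.
Import numFieldNormedType.Exports.

Local Open Scope classical_set_scope.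
Local Open Scope ring_scope.

(* R[i], given as a term of type numClosedFieldType so that the topology, the
   norm and the normed-module structure of a numFieldType are found on it. *)
Definition Cplx (R : realType) : numClosedFieldType := R[i].

Definition borelC (R : realType) := g_sigma_algebraType (@open (Cplx R)).

Section Circle.
Variable R : realType.
Local Notation C := (Cplx R).

(* All sets and functions "on the circle" are handled as sets and functions on
   C, only their part in circle being relevant.  As circle is closed in C,
   closures of its subsets may be computed in C. *)
Definition circle : set C := [set z | `|z| = 1].

Definition expi (t : R) : C := (cos t +i* sin t)%C.

Definition arc (s t : R) : set C := expi @` `]s, t[.

(* The class of finite unions of arcs does not depend on whether the circle
   itself, or the circle minus a point, counts as an interval: both are unions
   of two shorter arcs. *)
Definition finite_union_of_arcs (U : set C) :=
  exists s : seq (R * R), U = \bigcup_(p in [set` s]) arc p.1 p.2.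

Lemma twopi_gt0 : 0 < pi *+ 2 :> R.
Proof. by rewrite mulrn_wgt0 // pi_gt0. Qed.

Definition uniform_circle : set (borelC R) -> \bar R :=
  pushforward (uniform_prob twopi_gt0) (expi : _ -> borelC R).

(* The value is 0 if there is no minimum.  A minimum exists in the cases that
   matter: continuous images of nonempty compact sets, nonempty finite sets. *)
Definition set_min (S : set R) : R := xget 0 [set m | S m /\ lbound S m].

End Circle.

Section Mobius.
Variable R : realType.
Local Notation C := (Cplx R).

(* A transformation is given by its coefficients, with the SU(1,1) group law;
   (a, b) and (-a, -b) give the same map.  Composition and inverse agree with
   those of maps on the closed disc (mob_compE, mob_invK). *)
Record mobius := Mobius {
  mob_a : C;
  mob_b : C;
  mob_normalized : `|mob_a| ^+ 2 - `|mob_b| ^+ 2 = 1 }.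

(* The pole lies outside the closed unit disc; the value 0 that division by
   zero gives there is irrelevant. *)
Definition mob_fun (G : mobius) (z : C) : C :=
  (mob_a G * z + mob_b G) / ((mob_b G)^* * z + (mob_a G)^*).

Coercion mob_fun : mobius >-> Funclass.

Fact mob_id_normalized : `|1 : C| ^+ 2 - `|0 : C| ^+ 2 = 1.
Proof. by rewrite normr1 normr0 expr1n expr0n subr0. Qed.

Definition mob_id : mobius := Mobius mob_id_normalized.

Fact mob_inv_normalized (G : mobius) :
  `|(mob_a G)^*| ^+ 2 - `|- mob_b G| ^+ 2 = 1.
Proof. by rewrite norm_conjC normrN mob_normalized. Qed.

Definition mob_inv (G : mobius) : mobius := Mobius (mob_inv_normalized G).

Fact mob_comp_normalized (G H : mobius) :
  `|mob_a G * mob_a H + mob_b G * (mob_b H)^*| ^+ 2 -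
  `|mob_a G * mob_b H + mob_b G * (mob_a H)^*| ^+ 2 = 1.
Proof.
have := mob_normalized G; have := mob_normalized H.
rewrite !normCK !rmorphD !rmorphM /= !conjCK => h g.
rewrite -[RHS](mulr1 1) -[X in _ = X * _]g -[X in _ = _ * X]h.
ring.
Qed.

Definition mob_comp (G H : mobius) : mobius :=
  Mobius (mob_comp_normalized G H).

Lemma mob_denominator_neq0 (G : mobius) (z : C) : `|z| <= 1 ->
  (mob_b G)^* * z + (mob_a G)^* != 0.
Proof.
move=> z1; apply/negP; rewrite addr_eq0 => /eqP /(congr1 Num.norm).
rewrite normrN normrM !norm_conjC => ba.
have : `|mob_a G| ^+ 2 <= `|mob_b G| ^+ 2.
  by rewrite -ba exprMn ler_piMr ?exprn_ge0 // exprn_ile1.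
by rewrite -subr_le0 mob_normalized real_leNgt ?ltr01 // ?realE ?ler01 ?lexx.
Qed.

Lemma mob_idE (z : C) : mob_id z = z.
Proof. by rewrite /mob_fun /= conjC1 conjC0 mul0r add0r divr1 mul1r addr0. Qed.

Lemma mob_compE (G H : mobius) (z : C) : `|z| <= 1 ->
  mob_comp G H z = G (H z).
Proof.
move=> z1; have Hz := mob_denominator_neq0 H z1.
have GHz := mob_denominator_neq0 (mob_comp G H) z1.
move: Hz GHz; rewrite /mob_fun /= !rmorphD !rmorphM /= !conjCK.
move: (mob_a G) (mob_b G) (mob_a H) (mob_b H) => a b c d.
move: (a^*) (b^*) (c^*) (d^*) => a' b' c' d' Hz GHz.
have E : b' * ((c * z + d) / (d' * z + c')) + a' =
    ((a' * d' + b' * c) * z + (a' * c' + b' * d)) / (d' * z + c').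
  by field.
rewrite E; field; exact/andP.
Qed.

Lemma mob_invK (G : mobius) (z : C) : `|z| <= 1 -> mob_inv G (G z) = z.
Proof.
move=> z1; rewrite -mob_compE // /mob_fun /=.
have := mob_normalized G; rewrite !normCK => g.
have -> : (mob_a G)^* * mob_a G + - mob_b G * (mob_b G)^* = 1.
  by rewrite -[RHS]g; ring.
have -> : (mob_a G)^* * mob_b G + - mob_b G * (mob_a G)^* = 0 by ring.
by rewrite conjC0 conjC1 mul0r mul1r add0r addr0 divr1.
Qed.

Definition is_rotation (G : mobius) := mob_b G = 0.

Definition bullet (G : mobius) (x : C) : R :=
  ComplexField.Normc.normc (derive1 (G : C -> C) x).

(* Weak-star convergence of the pushforward measures to the Dirac measure,
   tested on the continuous functions on the circle. *)
Definition represents (G : nat -> mobius) (x : C) :=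
  circle x /\
  forall f : C -> R, {within @circle R, continuous f} ->
    (\int[pushforward (@uniform_circle R) (G n : borelC R -> borelC R)]_(z in
       @circle R) (f z)%:E)%E @[n --> \oo] -->
    (\int[\d_(x : borelC R)]_(z in @circle R) (f z)%:E)%E.

End Mobius.

Section Words.
Variable A : finType.

Definition infword : topologicalType :=
  prod_topology (fun _ : nat => discrete_topology A).

Definition prefix_of (w : infword) (n : nat) : seq A := mkseq w n.

Definition shift_word (w : infword) : infword := fun i => w i.+1.

Definition cylinder (v : seq A) : set infword :=
  [set w | prefix_of w (size v) = v].

Definition subshift (S : set infword) := closed S /\ shift_word @` S `<=` S.

Definition language (S : set infword) : set (seq A) :=
  [set v | exists2 w, S w &
    exists k, v = mkseq (fun i => w (k + i)%N) (size v)].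

End Words.

Section MobiusIterativeSystem.
Variables (R : realType) (A : finType) (F : A -> mobius R).
Local Notation C := (Cplx R).

Definition word_mob (v : seq A) : mobius R :=
  foldr (fun a G => mob_comp (F a) G) (mob_id R) v.

Definition Phi_defined (w : infword A) :=
  exists x, represents (fun n => word_mob (prefix_of w n)) x.

(* Meaningful only where Phi_defined holds; a represented point is unique. *)
Definition Phi (w : infword A) : C :=
  xget 0 [set x | represents (fun n => word_mob (prefix_of w n)) x].

Definition mobius_number_system (S : set (infword A)) :=
  [/\ subshift S, (forall w, S w -> Phi_defined w),
      Phi @` S = @circle R & {within S, continuous Phi}].

Definition interval_almost_cover (W : A -> set C) :=
  (forall a, finite_union_of_arcs (W a)) /\
  \bigcup_a closure (W a) = @circle R.

(* The factor circle only matters for the empty word. *)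
Definition refined (W : A -> set C) (u : seq A) : set C :=
  @circle R `&` \bigcap_(i : 'I_(size u))
    (word_mob (take i u) @` W (tnth (in_tuple u) i)).

Definition compatible (W : A -> set C) (S : set (infword A)) :=
  S !=set0 /\ forall v, language S v ->
    closure (refined W v) =
    \bigcup_(a in [set a | language S (rcons v a)])
      closure (refined W (rcons v a)).

Definition interval_shift (W : A -> set C) (S : set (infword A)) :
    set (infword A) :=
  [set w | S w /\ forall n, refined W (prefix_of w n) !=set0].

Definition qmin (W : A -> set C) (u : seq A) : R :=
  set_min [set bullet (mob_inv (word_mob u)) x | x in closure (refined W u)].

Definition Qmin (n : nat) (W : A -> set C) (S : set (infword A)) : R :=
  set_min [set qmin W u | u in
    [set u | language (interval_shift W S) u /\ size u = n]].

End MobiusIterativeSystem.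

(* Main.v *)
Require Import Defs.
From mathcomp Require Import all_boot all_order all_algebra.
From mathcomp Require Import all_classical all_reals all_analysis.
From mathcomp Require Import measurable_realfun complex ring lra.

Set Implicit Arguments.
Unset Strict Implicit.
Unset Printing Implicit Defensive.

Import Order.TTheory GRing.Theory Num.Theory.
Import numFieldNormedType.Exports.

Local Open Scope classical_set_scope.
Local Open Scope ring_scope.

(** Why the theorem holds.

    Let [w] be a word of the interval shift, let [y] lie in the closure of the
    refined set of every prefix of [w], and let [G_k] be the composition along
    the first [k] blocks of length [n] of [w].  Everything follows from the
    claim that [G_k] represents [y] ([centers_cvg] with
    [represents_of_center]).  Such a [y] exists for each [w], by compactness
    ([Sigma_point]).  For each point of the closure of a refined set there is
    such a [w], by compatibility ([point_extension]).  So the claim gives the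
    images of the cylinders ([Phi_cylinder]).  It also says that the closures
    of the refined sets shrink to the single point [Phi w], whence the
    continuity of [Phi], again by compactness ([Phi_continuous]).

    A sequence [G_k] represents a point [y] of the circle as soon as the
    centres [G_k 0] tend to [y].  Indeed the image of the uniform measure
    spreads around [G 0] with variance [1 - |G 0|^2]; this is the fact that
    the Poisson kernel has mean one ([poisson_integral],
    [integral_near_center]).

    It remains to see that [G_k 0] tends to [y].  If [Q_n > 1] a rotation is
    impossible, because its derivative has modulus one; so in both cases the
    inverses [N_k] of the block maps have derivative at least one on the
    closed refined sets and are not rotations ([Qmin_expand]).  In the Cayley
    coordinate [(x + z) / (x - z)], which sends the boundary point [x] to
    infinity, a Möbius map that sends [x] to [x'] becomes affine, with slope
    [lam], the reciprocal of the modulus of its derivative at [x], and a purely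
    imaginary translation by [tau] ([cay_mob]).  Along the orbit of [y] these maps compose
    to [T |-> mult_k T + i drift_k], which sends the coordinate of [G_k 0]
    to [1].  Hence [G_k 0] tends to [y] as soon as
    [(1 + drift_k^2) / mult_k^2] tends to infinity ([orbit_center]).

    The slopes are at most one, so [mult_k] decreases.  If it tends to zero
    the centres converge.  Otherwise the slopes tend to one, and the orbit of
    [y] approaches the endpoints of the arcs on which the [N_k] expand.  As
    there are finitely many block maps there are finitely many endpoints, and
    eventually each is sent exactly onto the next.  The chord from the orbit
    to the endpoint cannot shrink, since both derivatives are at least one;
    but it tends to zero, so it vanishes and the slopes are eventually
    exactly one ([olam_eventually1]).  From then on every step is a pure
    translation, of length bounded below because no block map is a rotation.
    All the translations have the same sign: the refined sets are open and
    nested, hence they accumulate at [y] from one fixed side ([one_side]), and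
    expansion on that side determines the sign ([tau_side]).  So [drift_k]
    diverges, as for the iterates of a parabolic map. *)

(** * Squared modulus *)

Section Sqn.
Variable R : realType.
Local Notation C := (Cplx R).
Implicit Types x y z : C.

(** The norm of [C] takes values in [C]; the squared modulus is real and
    polynomial, so metric arguments become real algebra. *)
Definition sqn (z : C) : R := complex.Re z ^+ 2 + complex.Im z ^+ 2.

Lemma sqnE z : (sqn z)%:C%C = z * z^*.
Proof. by rewrite /sqn add_Re2_Im2 normCK. Qed.

Lemma sqnM x y : sqn (x * y) = sqn x * sqn y.
Proof. by case: x => a b; case: y => c d; rewrite /sqn /=; ring. Qed.

Lemma sqn0 : sqn 0 = 0. Proof. by rewrite /sqn /=; ring. Qed.

Lemma sqn_ge0 z : 0 <= sqn z.
Proof. by rewrite addr_ge0 ?sqr_ge0. Qed.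

Lemma sqn_eq0 z : (sqn z == 0) = (z == 0).
Proof.
case: z => a b; rewrite /sqn paddr_eq0 ?sqr_ge0 //= !sqrf_eq0.
by rewrite eq_complex.
Qed.

Lemma sqn_gt0 z : (0 < sqn z) = (z != 0).
Proof. by rewrite lt0r sqn_eq0 sqn_ge0 andbT. Qed.

Lemma sqnN z : sqn (- z) = sqn z.
Proof. by case: z => a b; rewrite /sqn /= !sqrrN. Qed.

Lemma sqnBC x y : sqn (x - y) = sqn (y - x).
Proof. by rewrite -sqnN opprB. Qed.

Lemma sqnJ z : sqn z^* = sqn z.
Proof. by case: z => a b; rewrite /sqn /= sqrrN. Qed.

Lemma sqn_div x y : y != 0 -> sqn (x / y) = sqn x / sqn y.
Proof.
move=> y0; have sy0 : sqn y != 0 by rewrite sqn_eq0.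
by apply: (mulIf sy0); rewrite -sqnM !divfK.
Qed.

Lemma sqnD_le x y : sqn (x + y) <= 2 * (sqn x + sqn y).
Proof.
case: x => a b; case: y => c d; rewrite /sqn /=.
have h1 := sqr_ge0 (a - c); have h2 := sqr_ge0 (b - d); nra.
Qed.

Lemma sqn_ltP (z : C) (e : R) : 0 < e ->
  (`|z| < e%:C%C) = (sqn z < e ^+ 2).
Proof.
move=> e0; rewrite normc_def ltcR -/(sqn z).
by rewrite -[X in _ < X](gtr0_norm e0) -sqrtr_sqr ltr_sqrt ?exprn_gt0.
Qed.

Lemma circleP z : circle z <-> sqn z = 1.
Proof.
rewrite /circle /= normc_def -/(sqn z); split => [[] h|->]; last by rewrite sqrtr1.
by rewrite -(sqr_sqrtr (sqn_ge0 z)) h expr1n.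
Qed.

Lemma norm_le1P z : (`|z| <= 1) = (sqn z <= 1).
Proof.
rewrite normc_def -/(sqn z) -[1]/(1%:C%C) lecR.
by rewrite -[1 in LHS]sqrtr1 ler_sqrt.
Qed.

Lemma nbhs_sqnP z (P : set C) :
  nbhs z P <-> exists2 e : R, 0 < e & forall z', sqn (z' - z) < e -> P z'.
Proof.
split.
- move/nbhs_ballP => [[e1 e2] /= e0 h].
  move: e0; rewrite ltcE /= => /andP[/eqP e20 e10].
  exists (e1 ^+ 2); first by rewrite exprn_gt0.
  move=> z' z'z; apply: h; rewrite -ball_normE /ball_ /=.
  have -> : (e1 +i* e2)%C = e1%:C%C by rewrite e20.
  by rewrite sqn_ltP // sqnBC.
- move=> [e e0 h]; apply/nbhs_ballP; exists (Num.sqrt e)%:C%C => /=.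
    by rewrite ltcR sqrtr_gt0.
  move=> z'; rewrite -ball_normE /ball_ /= sqn_ltP ?sqrtr_gt0 //.
  by rewrite sqr_sqrtr ?ltW // sqnBC; exact: h.
Qed.

Lemma circle_conjV z : circle z -> z^* = z^-1.
Proof.
move=> /circleP z1; have z0 : z != 0 by rewrite -sqn_eq0 z1 oner_eq0.
by apply: (mulfI z0); rewrite divff // -sqnE z1.
Qed.

Lemma circle_neq0 z : circle z -> z != 0.
Proof. by move=> /circleP z1; rewrite -sqn_eq0 z1 oner_eq0. Qed.

Lemma cvg_sqn_lipschitz (f : C -> C) x (K : R) : 0 <= K ->
  (forall z, sqn (f z - f x) <= K * sqn (z - x)) -> f z @[z --> x] --> f x.
Proof.
move=> K0 h P /nbhs_sqnP[e e0 eP].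
have K1 : 0 < K + 1 by lra.
apply/nbhs_sqnP; exists (e / (K + 1)); first by rewrite divr_gt0.
move=> z; rewrite ltr_pdivlMr // => zx; apply: eP; apply: le_lt_trans (h z) _.
by apply: le_lt_trans zx; rewrite mulrC ler_wpM2l ?sqn_ge0 //; lra.
Qed.

Lemma closure_sqnP (U : set C) z :
  closure U z <-> forall e : R, 0 < e -> exists2 w, U w & sqn (w - z) < e.
Proof.
split=> [h e e0|h B /nbhs_sqnP[e e0 he]].
  have [w [Uw wz]] : U `&` [set w | sqn (w - z) < e] !=set0.
    by apply: h; apply/nbhs_sqnP; exists e.
  by exists w.
by have [w Uw wz] := h e e0; exists w; split => //; exact: he.
Qed.

End Sqn.

(** * Möbius calculus *)

Section MobiusCalculus.
Variable R : realType.
Local Notation C := (Cplx R).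
Implicit Types (x y z : C) (G : mobius R).

Definition den G z : C := (mob_b G)^* * z + (mob_a G)^*.

(** The reciprocal of [bullet] on the circle ([bulletE]); unlike the derivative
    it is a polynomial in the real coordinates. *)
Definition lam G z : R := sqn (den G z).

Lemma mob_normalizedE G : sqn (mob_a G) - sqn (mob_b G) = 1.
Proof.
have := mob_normalized G.
by rewrite !normCK -!sqnE -rmorphB => -[].
Qed.

Lemma mob_normalizedC G :
  mob_a G * (mob_a G)^* - mob_b G * (mob_b G)^* = 1.
Proof. by rewrite -!normCK mob_normalized. Qed.

Lemma sqn_mob_aE G : mob_a G * (mob_a G)^* = 1 + mob_b G * (mob_b G)^*.
Proof. by rewrite -(mob_normalizedC G) subrK. Qed.

Lemma den_neq0 G z : sqn z <= 1 -> den G z != 0.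
Proof. by rewrite -norm_le1P; exact: mob_denominator_neq0. Qed.

Lemma lam_gt0 G z : sqn z <= 1 -> 0 < lam G z.
Proof. by move=> z1; rewrite sqn_gt0 den_neq0. Qed.

Lemma mob_a_neq0 G : mob_a G != 0.
Proof.
rewrite -sqn_eq0; apply/eqP => a0; have := mob_normalizedE G.
by have := sqn_ge0 (mob_b G); rewrite a0; lra.
Qed.

Lemma mob_subE G x z : den G x != 0 -> den G z != 0 ->
  G x - G z = (x - z) / (den G x * den G z).
Proof.
move=> x0 z0.
have e := sqn_mob_aE G; rewrite /mob_fun; rewrite /den in x0 z0 *.
move: (mob_a G) (mob_b G) ((mob_a G)^*) ((mob_b G)^*) e x0 z0 => a b a' b' e x0 z0.
have -> : x - z = (x - z) * (a * a' - b * b') by rewrite e; ring.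
by field; apply/andP.
Qed.

Lemma mob_dist G x z : sqn x <= 1 -> sqn z <= 1 ->
  sqn (G x - G z) = sqn (x - z) / (lam G x * lam G z).
Proof.
move=> /(den_neq0 G) x1 /(den_neq0 G) z1.
by rewrite mob_subE // sqn_div ?sqnM // mulf_neq0.
Qed.

Lemma mob_onem_sqn G z : sqn z <= 1 -> 1 - sqn (G z) = (1 - sqn z) / lam G z.
Proof.
move=> z1; have l0 := lam_gt0 G z1.
rewrite /mob_fun sqn_div ?den_neq0 // -/(lam G z).
have E : lam G z - sqn (mob_a G * z + mob_b G) = 1 - sqn z.
  rewrite -[1 - _]mul1r -{1}(mob_normalizedE G) /lam /den.
  move: (mob_a G) (mob_b G) => [a1 a2] [b1 b2]; case: z {z1 l0} => z1 z2.
  by rewrite /sqn /=; ring.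
by rewrite -E mulrBl divff // gt_eqF.
Qed.

Lemma circle_sqn_le1 z : circle z -> sqn z <= 1.
Proof. by move=> /circleP ->. Qed.

Lemma mob_inj_disc G x z : sqn x <= 1 -> sqn z <= 1 ->
  x != z -> G x != G z.
Proof.
move=> x1 z1 xz; rewrite -subr_eq0 -sqn_eq0 mob_dist // gt_eqF //.
by rewrite divr_gt0 ?mulr_gt0 ?lam_gt0 // sqn_gt0 subr_eq0.
Qed.

Lemma mob_le1 G z : sqn z <= 1 -> sqn (G z) <= 1.
Proof.
move=> z1; rewrite -subr_ge0 mob_onem_sqn //.
by rewrite divr_ge0 ?subr_ge0 // ltW // lam_gt0.
Qed.

Lemma mob_circle G z : circle z -> circle (G z).
Proof.
move=> z1; apply/circleP; have := mob_onem_sqn G (circle_sqn_le1 z1).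
by move/circleP: z1 => ->; rewrite subrr mul0r => /subr0_eq.
Qed.

Lemma mob_disc G z : sqn z < 1 -> sqn (G z) < 1.
Proof.
move=> z1; rewrite -subr_gt0 mob_onem_sqn ?ltW //.
by rewrite divr_gt0 ?subr_gt0 // lam_gt0 ?ltW.
Qed.

Lemma mob_inv_cancel G z : sqn z <= 1 -> mob_inv G (G z) = z.
Proof. by rewrite -norm_le1P; exact: mob_invK. Qed.

Lemma mob_cancel_inv G z : sqn z <= 1 -> G (mob_inv G z) = z.
Proof.
move=> z1; rewrite -[RHS](mob_inv_cancel (mob_inv G) z1).
by rewrite /mob_fun /= !conjCK opprK.
Qed.

(** Translation length of [G] in the Cayley coordinates based at [x] and at
    [G x]; see [cay_mob]. *)
Definition tau G x : R := 2 * complex.Im (mob_a G * (mob_b G)^* * x).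

(** The disc becomes the right half-plane, [x] becomes infinity and the
    centre becomes 1. *)
Definition cay x z : C := (x + z) / (x - z).

(** The coordinate change sends both base points to infinity, so the map is an
    affine automorphism of the right half-plane. *)
Lemma cay_mob G x z : circle x -> sqn z <= 1 -> x != z ->
  cay (G x) (G z) = (lam G x)%:C%C * cay x z - 'i%C * (tau G x)%:C%C.
Proof.
move=> xC z1 xz; have x1 := circle_sqn_le1 xC.
have tauE : 'i%C * (tau G x)%:C%C =
    mob_a G * (mob_b G)^* * x - (mob_a G)^* * mob_b G * x^-1.
  rewrite -circle_conjV // /tau; move: (mob_a G) (mob_b G) => [a1 a2] [b1 b2].
  case: x {xC x1 xz} => x1 x2.
  by apply/eqP; rewrite eq_complex /=; apply/andP; split; apply/eqP; ring.
have dx := den_neq0 G x1; have dz := den_neq0 G z1; have x0 := circle_neq0 xC.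
have xz0 : x - z != 0 by rewrite subr_eq0.
rewrite tauE /cay mob_subE // /lam sqnE.
have e := sqn_mob_aE G; rewrite /mob_fun -/(den G x) -/(den G z).
have -> : (den G x)^* = mob_b G * x^-1 + mob_a G.
  by rewrite /den rmorphD rmorphM /= !conjCK circle_conjV.
have -> : (mob_a G * x + mob_b G) / den G x + (mob_a G * z + mob_b G) / den G z
  = ((mob_a G * x + mob_b G) * den G z + (mob_a G * z + mob_b G) * den G x)
    / (den G x * den G z) by field; apply/andP.
rewrite invf_div mulrA divfK ?mulf_neq0 //.
set num := (X in X / (x - z)).
set q := mob_a G * (mob_b G)^* * x - _.
have -> : num = (den G x * (mob_b G * x^-1 + mob_a G)) * (x + z) - q * (x - z).
  by rewrite /num /q /den; field.
by rewrite mulrBl mulfK // mulrA.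
Qed.

Lemma lam_diff G x z : sqn x = sqn z ->
  lam G z - lam G x = 2 * complex.Re (mob_a G * (mob_b G)^* * (z - x)).
Proof.
rewrite /lam /den; move: (mob_a G) (mob_b G) => [a1 a2] [b1 b2].
case: x => x1 x2; case: z => z1 z2; rewrite /sqn /= => e.
apply/eqP; rewrite -subr_eq0; apply/eqP.
transitivity ((b1 ^+ 2 + b2 ^+ 2) * ((z1 ^+ 2 + z2 ^+ 2) - (x1 ^+ 2 + x2 ^+ 2))).
  by ring.
by rewrite e subrr mulr0.
Qed.

Lemma cay_sqn x z : x != z -> sqn (x - z) * sqn (cay x z) = sqn (x + z).
Proof.
by move=> xz; rewrite /cay -sqnM mulrC divfK // subr_eq0.
Qed.

Lemma cay_circle x z : circle x -> circle z -> complex.Re (cay x z) = 0.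
Proof.
move=> /circleP xE /circleP zE; case: (eqVneq x z) => [->|xz].
  by rewrite /cay subrr invr0 mulr0.
have s0 : sqn (x - z) != 0 by rewrite sqn_eq0 subr_eq0.
apply: (mulIf s0); rewrite mul0r -[RHS](subrr (sqn x)) {2}xE -zE.
have : cay x z * (x - z) = x + z by rewrite divfK // subr_eq0.
move: (cay x z) => [s t] /eqP; rewrite eq_complex {xE zE s0 xz}.
case: x => x1 x2; case: z => z1 z2; rewrite /sqn /= => /andP[/eqP e1 /eqP e2].
transitivity ((s * (x1 - z1) - t * (x2 - z2)) * (x1 - z1)
  + (s * (x2 - z2) + t * (x1 - z1)) * (x2 - z2)); first by ring.
by rewrite e1 e2; ring.
Qed.

(** The sign of [lam G z - lam G x] is governed by an expression that is affine
    in the coordinate of [z].  Near [x] this coordinate is large, so the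
    imaginary part of [a b^* x], that is [tau], decides on which side of [x]
    the map expands more. *)
Lemma lam_cay G x z : circle x -> circle z -> x != z ->
  (lam G z - lam G x) * (1 + complex.Im (cay x z) ^+ 2) =
  - 4 * (complex.Re (mob_a G * (mob_b G)^* * x)
         + complex.Im (cay x z) * complex.Im (mob_a G * (mob_b G)^* * x)).
Proof.
move=> xC zC xz.
have e : (z - x) * (1 + cay x z) = - 2 * x.
  have xz0 : x - z != 0 by rewrite subr_eq0.
  by rewrite /cay; field.
have := cay_circle xC zC.
rewrite lam_diff; last by move/circleP: xC => ->; move/circleP: zC => ->.
move: (cay x z) e => [s' s] e /= s0; rewrite {s'}s0 in e.
set v := mob_a G * _.
have {e} : v * (z - x) * (1 + (0 +i* s)%C) = - 2 * (v * x).
  by rewrite -mulrA e; ring.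
case: (v * (z - x)) => u1 u2; case: (v * x) => w1 w2 /= /eqP.
rewrite eq_complex /= => /andP[/eqP e1 /eqP e2].
transitivity (2 * ((u1 * (1 + 0) - u2 * (0 + s)) + s * (u1 * (0 + s) + u2 * (1 + 0)))).
  by ring.
by rewrite e1 e2; ring.
Qed.

Lemma lam_expand G z : circle z ->
  lam G z = 1 + 2 * sqn (mob_b G) + 2 * complex.Re (mob_a G * (mob_b G)^* * z).
Proof.
move=> /circleP z1; have e := mob_normalizedE G.
have -> : lam G z = sqn (mob_b G) * sqn z + sqn (mob_a G) +
    2 * complex.Re (mob_a G * (mob_b G)^* * z).
  rewrite /lam /den; move: (mob_a G) (mob_b G) => [a1 a2] [b1 b2].
  by case: z {z1} => z1 z2; rewrite /sqn /=; ring.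
by rewrite z1; lra.
Qed.

Lemma ReIm_ab G z : circle z ->
  complex.Re (mob_a G * (mob_b G)^* * z) ^+ 2 +
  complex.Im (mob_a G * (mob_b G)^* * z) ^+ 2 =
  sqn (mob_b G) * (1 + sqn (mob_b G)).
Proof.
move=> /circleP z1; have e := mob_normalizedE G; rewrite -/(sqn _) !sqnM sqnJ z1.
have -> : sqn (mob_a G) = 1 + sqn (mob_b G) by lra.
by ring.
Qed.

(** At a point where the derivative has modulus one, only a rotation has no
    translation part. *)
Lemma tau_sqr G z : circle z -> lam G z = 1 -> tau G z ^+ 2 = 4 * sqn (mob_b G).
Proof.
move=> zC l1; have := lam_expand G zC; have := ReIm_ab G zC; rewrite /tau l1.
move: (complex.Re _) (complex.Im _) (sqn _) => r i b e1 e2.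
have e3 : r = - b by lra.
by rewrite e3 in e1; lra.
Qed.

(** The two solutions of [lam G z = 1] on the circle, that is, the endpoints of
    the arc where [G] expands: there the real part of [a b^* z] is [- |b|^2],
    and its modulus is [|a| |b|]. *)
Definition endpoint (s : bool) G : C :=
  (- sqn (mob_b G) +i* (if s then Num.sqrt (sqn (mob_b G))
                        else - Num.sqrt (sqn (mob_b G))))%C
  / (mob_a G * (mob_b G)^*).

Lemma ab_neq0 G : mob_b G != 0 -> mob_a G * (mob_b G)^* != 0.
Proof. by move=> b0; rewrite mulf_neq0 ?mob_a_neq0 // conjC_eq0. Qed.

Lemma endpoint_circle s G : mob_b G != 0 -> circle (endpoint s G).
Proof.
move=> b0; apply/circleP; rewrite sqn_div ?ab_neq0 // sqnM sqnJ.
have -> : sqn (mob_a G) = 1 + sqn (mob_b G) by have := mob_normalizedE G; lra.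
have sb0 : sqn (mob_b G) != 0 by rewrite sqn_eq0.
rewrite {1}/sqn /=.
have -> : (if s then Num.sqrt (sqn (mob_b G)) else - Num.sqrt (sqn (mob_b G))) ^+ 2
   = sqn (mob_b G).
  by case: s; rewrite ?sqrrN sqr_sqrtr // sqn_ge0.
have : 0 < sqn (mob_b G) by rewrite sqn_gt0.
move: (sqn _) sb0 => b b0' bpos; field.
by rewrite b0' /= gt_eqF //; lra.
Qed.

Lemma lam_endpoint s G : mob_b G != 0 -> lam G (endpoint s G) = 1.
Proof.
move=> b0; rewrite lam_expand; last exact: endpoint_circle.
by rewrite /endpoint [X in complex.Re X]mulrC divfK ?ab_neq0 //=; lra.
Qed.

(** A point where [G] barely expands is close to an endpoint, with a bound that
    depends on [G] through [|b|] only. *)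
Lemma near_endpoint G z : mob_b G != 0 -> circle z -> 0 <= lam G z <= 1 ->
  exists s, sqn (mob_b G) * sqn (z - endpoint s G) <= 1 - lam G z.
Proof.
move=> b0 zC /andP[l0 l1].
have sb0 : 0 < sqn (mob_b G) by rewrite sqn_gt0.
have eq1 := ReIm_ab G zC; have eq2 := lam_expand G zC.
have eab : sqn (mob_a G * (mob_b G)^*) = (1 + sqn (mob_b G)) * sqn (mob_b G).
  by rewrite sqnM sqnJ; congr (_ * _); have := mob_normalizedE G; lra.
have E s : (1 + sqn (mob_b G)) * (sqn (mob_b G) * sqn (z - endpoint s G)) =
   sqn (mob_a G * (mob_b G)^* * z -
   (- sqn (mob_b G) +i* (if s then Num.sqrt (sqn (mob_b G))
                        else - Num.sqrt (sqn (mob_b G))))%C).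
  rewrite mulrA -eab -sqnM mulrBr; congr (sqn (_ - _)).
  by rewrite /endpoint mulrC divfK ?ab_neq0.
exists (0 <= complex.Im (mob_a G * (mob_b G)^* * z)).
have a0 : 0 < 1 + sqn (mob_b G) by lra.
rewrite -(ler_pM2l a0) E.
move: (mob_a G * _ * z) eq1 eq2 => [r i] /= eq1 eq2.
have := sqr_sqrtr (ltW sb0); have := sqrtr_ge0 (sqn (mob_b G)).
move: (sqn (mob_b G)) (Num.sqrt _) (lam G z) l0 l1 sb0 eq1 eq2 {E a0 eab} => b t l.
move=> l0 l1 b0' eq1 eq2 t0 tb; rewrite /sqn /=.
have er : r = - b - (1 - l) / 2 by lra.
have {}eq1 : i ^+ 2 = t ^+ 2 - (1 - l) * t ^+ 2 - (1 - l) ^+ 2 / 4.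
  by rewrite tb; rewrite er in eq1; lra.
rewrite er -tb.
have [i0|i0] := leP 0 i.
  have it : i <= t.
    rewrite -ler_sqr ?nnegrE // eq1.
    have := sqr_ge0 (1 - l).
    have : 0 <= (1 - l) * t ^+ 2 by rewrite mulr_ge0 ?sqr_ge0 //; lra.
    lra.
  have : (i - t) ^+ 2 <= t ^+ 2 - i ^+ 2 by nra.
  rewrite eq1; nra.
have it : - i <= t.
  rewrite -ler_sqr ?nnegrE // ?sqrrN ?eq1; last by lra.
  have := sqr_ge0 (1 - l).
  have : 0 <= (1 - l) * t ^+ 2 by rewrite mulr_ge0 ?sqr_ge0 //; lra.
  lra.
have : (i + t) ^+ 2 <= t ^+ 2 - i ^+ 2 by nra.
rewrite eq1; nra.
Qed.

Lemma den_cont G x : den G z @[z --> x] --> den G x.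
Proof.
apply: (@cvg_sqn_lipschitz _ (den G) _ (sqn (mob_b G))) => [|z]; first exact: sqn_ge0.
rewrite (_ : _ - _ = (mob_b G)^* * (z - x)); last by rewrite /den; ring.
by rewrite sqnM sqnJ.
Qed.

(** The divided differences of [G] at [x] are [1 / (den G x * den G (x + h))],
    by [mob_subE]. *)
Lemma bulletE G x : circle x -> bullet G x = (lam G x)^-1.
Proof.
move=> xC; have d0 := den_neq0 G (circle_sqn_le1 xC).
have l0 : lam G x != 0 by rewrite gt_eqF // lam_gt0 // circle_sqn_le1.
rewrite /bullet; suff -> : derive1 (G : C -> C) x = (den G x * den G x)^-1.
  apply: (mulIf l0); rewrite mulVf //.
  rewrite ComplexField.Normc.normcV ComplexField.Normc.normcM.
  have -> : ComplexField.Normc.normc (den G x) = Num.sqrt (lam G x).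
    by rewrite /lam /sqn; case: (den G x).
  by rewrite -expr2 sqr_sqrtr ?sqn_ge0 // mulVf.
apply: cvg_lim => //.
have h1 : (fun h : C => h + x) @ (0:C) --> x.
  move=> P /nbhs_sqnP[e e0 eP]; apply/nbhs_sqnP; exists e => // z.
  by rewrite subr0 => ze; apply: eP; rewrite addrK.
have h2 : den G (h + x) @[h --> (0:C)] --> den G x.
  exact: (cvg_comp _ _ h1 (@den_cont G x)).
have h3 : (den G (h + x) * den G x)^-1 @[h --> (0:C)] --> (den G x * den G x)^-1.
  have h4 : den G (h + x) * den G x @[h --> (0:C)] --> den G x * den G x.
    exact: (cvgM h2 (cvg_cst _)).
  exact: (cvgV (mulf_neq0 d0 d0) h4).
move=> P /h3 hP.
have : \forall h \near (0:C), den G (h + x) != 0.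
  apply: (h2 [set w | w != 0]); apply/nbhs_sqnP.
  exists (sqn (den G x)); first by rewrite sqn_gt0.
  move=> z; apply: contraTneq => ->.
  by rewrite sub0r sqnN ltxx.
move=> dn; suff : \forall h \near (0:C), h != 0 -> P (h^-1 *: (G (h + x) - G x)) by [].
have {}hP : \forall h \near (0:C), P ((den G (h + x) * den G x)^-1) by [].
apply: filterS2 dn hP => h dh hP h0.
by rewrite mob_subE // addrK -[X in P X]/(h^-1 * _) mulrA mulVf // mul1r.
Qed.

Lemma mob_cont G x : den G x != 0 -> G z @[z --> x] --> G x.
Proof.
move=> d0.
have h : mob_a G * z + mob_b G @[z --> x] --> mob_a G * x + mob_b G.
  apply: (@cvg_sqn_lipschitz _ (fun z => mob_a G * z + mob_b G) _ (sqn (mob_a G))) => [|z].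
    exact: sqn_ge0.
  by rewrite (_ : _ - _ = mob_a G * (z - x)) ?sqnM //; ring.
exact: (cvgM h (cvgV d0 (@den_cont G x))).
Qed.

End MobiusCalculus.

(** * Convergence of the centres *)

Lemma finite_gap (R : realType) (T : finType) (f : T -> R) :
  exists2 d : R, 0 < d & forall t, 0 < f t -> d <= f t.
Proof.
suff : \forall d \near (0:R)^'+, forall t, 0 < f t -> d <= f t.
  move=> /(filterI (nbhs_right_gt 0)) /filter_ex [d [d0 hd]].
  by exists d.
apply: filter_forall => t.
have [ft|ft] := ltP 0 (f t); last by near=> d => ft'.
by near=> d => _; near: d; exact: nbhs_right_le.
Unshelve. all: by end_near. Qed.

Section Orbit.
Variable R : realType.
Local Notation C := (Cplx R).
Variable N : nat -> mobius R.

(** [N k] stands for the inverse of the [k]-th block map; the orbit of [z] is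
    the sequence of its images under the inverses of the compositions. *)
Fixpoint orbit (k : nat) (z : C) : C :=
  if k is k'.+1 then N k' (orbit k' z) else z.

Lemma orbit_le1 k z : sqn z <= 1 -> sqn (orbit k z) <= 1.
Proof. by move=> z1; elim: k => [//|k IH] /=; apply: mob_le1. Qed.

Lemma orbit_circle k z : circle z -> circle (orbit k z).
Proof. by move=> z1; elim: k => [//|k IH] /=; apply: mob_circle. Qed.

Lemma orbit_inj k x z : sqn x <= 1 -> sqn z <= 1 -> x != z ->
  orbit k x != orbit k z.
Proof.
move=> x1 z1 xz; elim: k => [//|k IH] /=.
by apply: mob_inj_disc IH; apply: orbit_le1.
Qed.

Variable y : C.
Hypothesis yC : circle y.

Definition olam k : R := lam (N k) (orbit k y).

Definition mult k : R := \prod_(j < k) olam j.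

(** Along the orbit of [y] the affine maps of [cay_mob] compose to
    [T |-> mult k * T + i * drift k]; see [cay_orbit]. *)
Fixpoint drift k : R :=
  if k is k'.+1 then olam k' * drift k' - tau (N k') (orbit k' y) else 0.

Lemma olam_gt0 k : 0 < olam k.
Proof. by apply: lam_gt0; apply: orbit_le1; apply: circle_sqn_le1. Qed.

Lemma mult_gt0 k : 0 < mult k.
Proof. by apply: prodr_gt0 => i _; exact: olam_gt0. Qed.

Lemma cay_orbit k z : sqn z <= 1 -> y != z ->
  complex.Re (cay (orbit k y) (orbit k z)) = mult k * complex.Re (cay y z) /\
  complex.Im (cay (orbit k y) (orbit k z)) = mult k * complex.Im (cay y z) + drift k.
Proof.
move=> z1 yz; have y1 := circle_sqn_le1 yC.
elim: k => [|k [IHr IHi]]; first by rewrite /mult big_ord0 !mul1r addr0.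
have cr := cay_mob (N k) (orbit_circle k yC) (orbit_le1 k z1) (orbit_inj k y1 z1 yz).
rewrite [orbit _ y]/= [orbit _ z]/= cr -/(olam k) /mult big_ord_recr /= -/(mult k).
move: (cay (orbit k y) _) IHr IHi => [s t] /= -> ->.
by split; ring.
Qed.

(** The coordinate [T] of [p] satisfies [mult k * T + i * drift k = 1], and
    [|y - p| |T| = |y + p| <= 2]. *)
Lemma orbit_center k (p : C) : sqn p < 1 -> orbit k p = 0 ->
  sqn (y - p) * (1 + drift k ^+ 2) <= 4 * mult k ^+ 2.
Proof.
move=> p1 p0; have y1 := circle_sqn_le1 yC.
have yp : y != p by apply: contraTneq p1 => <-; move/circleP: yC => ->; rewrite ltxx.
have [] := cay_orbit k (ltW p1) yp; rewrite p0.
have := cay_sqn yp; have : sqn (y + p) <= 4.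
  by apply: le_trans (sqnD_le _ _) _; lra.
have -> : cay (orbit k y) 0 = 1.
  by rewrite /cay addr0 subr0 divff // circle_neq0 //; exact: orbit_circle.
have := sqn_ge0 (y - p); have := mult_gt0 k.
move: (mult k) (drift k) (sqn (y + p)) (sqn (y - p)) => m d A B m0 B0 A4.
case: (cay y p) => s t.
rewrite [complex.Re 1]/= [complex.Im 1]/= [complex.Re _]/= [complex.Im _]/=.
rewrite /sqn /= => e e1 e2.
have -> : 1 + d ^+ 2 = m ^+ 2 * (s ^+ 2 + t ^+ 2).
  have -> : d = - (m * t) by lra.
  by transitivity ((m * s) ^+ 2 + (m * t) ^+ 2); [rewrite -e1 expr1n sqrrN | ring].
by rewrite mulrCA e mulrC ler_wpM2r // sqr_ge0.
Qed.

Lemma mult_le k K : (forall k, olam k <= 1) -> (K <= k)%N -> mult k <= mult K.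
Proof.
move=> l1; elim: k => [|k IH]; first by rewrite leqn0 => /eqP ->.
rewrite leq_eqVlt => /orP[/eqP -> //|/IH]; apply: le_trans.
by rewrite /mult big_ord_recr /= ler_piMr // ltW // mult_gt0.
Qed.

Lemma center_cvg_mult0 (p : nat -> C) :
  (forall k, sqn (p k) < 1) -> (forall k, orbit k (p k) = 0) ->
  (forall k, olam k <= 1) ->
  (forall e : R, 0 < e -> exists k, mult k < e) ->
  forall e : R, 0 < e -> exists K, forall k, (K <= k)%N -> sqn (p k - y) < e.
Proof.
move=> p1 p0 l1 m0 e e0.
have e1 : 0 < Num.min 1 (e / 4) by rewrite lt_min ltr01 divr_gt0.
have [K hK] := m0 _ e1.
exists K => k /(mult_le l1) Kk; rewrite sqnBC.
have := orbit_center (p1 k) (p0 k); have := mult_gt0 k.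
have := sqn_ge0 (y - p k); have := sqr_ge0 (drift k).
have : mult k < Num.min 1 (e / 4) by apply: le_lt_trans hK.
rewrite lt_min; move: (mult k) (sqn _) (drift k ^+ 2) => m s d /andP[m1 m2] d0 s0 mp h.
have : s <= 4 * m ^+ 2 by apply: le_trans h; nra.
nra.
Qed.

Lemma olam_to1 (L : R) : (forall k, olam k <= 1) -> 0 < L ->
  (forall k, L <= mult k) ->
  forall e : R, 0 < e -> exists K, forall k, (K <= k)%N -> 1 - olam k < e.
Proof.
move=> l1 L0 hL e e0.
have mc : cvgn mult.
  apply: nonincreasing_is_cvgn.
    by move=> k K kK; apply: mult_le.
  by exists L => _ [k _ <-].
have eL : 0 < e * L / 2 by rewrite divr_gt0 ?mulr_gt0.
have /cvgrPdist_lt /(_ _ eL) [K _ hK] : mult @ \oo --> limn mult by [].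
exists K => k Kk; have := hK k Kk; have := hK k.+1 (leqW Kk); have := hL k.
have := olam_gt0 k; have := l1 k.
rewrite /= !ltr_norml [mult k.+1]/mult big_ord_recr /= -/(mult k).
move: (limn mult) (mult k) (olam k) => l m o o1 o0 Lm /andP[h1 h2] /andP[h3 h4].
have h5 : (1 - o) * m < e * L by lra.
have h6 : (1 - o) * L <= (1 - o) * m by rewrite ler_wpM2l // subr_ge0.
by rewrite -(ltr_pM2r L0); lra.
Qed.

Variables (I : finType) (h : I -> mobius R) (i_ : nat -> I).
Hypothesis Nh : forall k, N k = h (i_ k).
Hypothesis nonrot : forall k, mob_b (N k) != 0.

(** The distance [d k] of the orbit to a nearest endpoint tends to zero, by
    [near_endpoint].  The block maps have finitely many endpoints, so the image
    of the endpoint chosen at time [k], being close to the one chosen at time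
    [k + 1], must equal it.  By [mob_dist] the distance then cannot decrease,
    so it is zero. *)
Lemma olam_eventually1 (L : R) : (forall k, olam k <= 1) -> 0 < L ->
  (forall k, L <= mult k) ->
  exists K, forall k, (K <= k)%N -> olam k = 1.
Proof.
move=> l1 L0 hL.
have [d1 d10 hd1] := finite_gap (fun i => sqn (mob_b (h i))).
(* [d2] separates the images of endpoints from the endpoints they miss. *)
have [d2 d20 hd2] := finite_gap (fun t : (I * bool) * (I * bool) =>
  sqn (h t.1.1 (endpoint t.1.2 (h t.1.1)) - endpoint t.2.2 (h t.2.1))).
have [s_ hs] : exists s : nat -> bool, forall k,
    sqn (mob_b (N k)) * sqn (orbit k y - endpoint (s k) (N k)) <= 1 - olam k.
  suff /boolp.choice [s hs] : forall k, exists s,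
      sqn (mob_b (N k)) * sqn (orbit k y - endpoint s (N k)) <= 1 - olam k.
    by exists s.
  move=> k; apply: near_endpoint => //; first exact: orbit_circle.
  by rewrite l1 ltW // olam_gt0.
pose e k := endpoint (s_ k) (N k).
pose d k := sqn (orbit k y - e k).
have eC k : circle (e k) by exact: endpoint_circle.
have dl k : d1 * d k <= 1 - olam k.
  apply: le_trans (hs k); rewrite ler_wpM2r ?sqn_ge0 // Nh; apply: hd1.
  by rewrite sqn_gt0 -Nh.
have dS k : sqn (N k (orbit k y) - N k (e k)) = d k / olam k.
  rewrite mob_dist ?circle_sqn_le1 //; last exact: orbit_circle.
  by rewrite lam_endpoint // mulr1.
have [K hK] : exists K, forall k, (K <= k)%N -> N k (e k) = e k.+1.
  (* The triangle inequality for [sqn] bounds the squared distance of the image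
     to the next endpoint by [2 * (2 * d k + d k.+1)], and this is less than
     [d2] if both [1 - olam] are less than [d1 * d2 / 8]; the inner factor 2
     comes from [olam k >= 1 / 2]. *)
  have eta0 : 0 < Num.min (1 / 2) (d1 * d2 / 8).
    by rewrite lt_min !divr_gt0 ?mulr_gt0.
  have [K hK] := olam_to1 l1 L0 hL eta0.
  exists K => k Kk; apply/eqP; rewrite -subr_eq0 -sqn_eq0.
  case: (eqVneq (sqn _) 0) => // ne0; exfalso.
  have := hd2 ((i_ k, s_ k), (i_ k.+1, s_ k.+1)); rewrite /= -!Nh -/(e k) -/(e k.+1).
  rewrite lt0r ne0 sqn_ge0 => /(_ isT).
  have -> : N k (e k) - e k.+1 =
      (N k (e k) - N k (orbit k y)) + (orbit k.+1 y - e k.+1) by rewrite /= addrA subrK.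
  move=> /le_trans /(_ (sqnD_le _ _)); rewrite (sqnBC (N k (e k))) dS -/(d k.+1).
  have := hK _ Kk; have := hK _ (leqW Kk); have := dl k; have := dl k.+1.
  rewrite !lt_min => D1 D0 /andP[a1 a2] /andP[a3 a4].
  have o2 : 1 / 2 <= olam k by lra.
  have : d k / olam k <= 2 * d k.
    rewrite ler_pdivrMr ?olam_gt0 //.
    have := sqn_ge0 (orbit k y - e k); rewrite -/(d k); nra.
  move=> b1 b2.
  have : d1 * d2 <= d1 * (2 * (2 * d k + d k.+1)) by rewrite ler_pM2l //; lra.
  by have := mulr_gt0 d10 d20; lra.
have dinc m k : (K <= m)%N -> (m <= k)%N -> d m <= d k.
  move=> Km; elim: k => [|k IH]; first by rewrite leqn0 => /eqP ->.
  rewrite leq_eqVlt => /orP[/eqP -> //|mk]; apply: le_trans (IH mk) _.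
  rewrite [d k.+1]/d -hK ?(leq_trans Km) // dS ler_pdivlMr ?olam_gt0 //.
  by rewrite ler_piMr // sqn_ge0.
exists K => m Km.
have dm0 : d m = 0.
  apply/eqP; rewrite eq_le sqn_ge0 andbT leNgt; apply/negP => dm.
  have [K' hK'] := olam_to1 l1 L0 hL (mulr_gt0 d10 dm).
  have := hK' (maxn m K') (leq_maxr _ _); rewrite ltNge => /negP; apply.
  by apply: le_trans (dl _); rewrite ler_pM2l // dinc // leq_maxl.
have /eqP : d m = 0 by [].
rewrite sqn_eq0 subr_eq0 /olam => /eqP ->.
by rewrite lam_endpoint.
Qed.

(** On the side [eps] of [y] there are points arbitrarily close to [y] where
    [N k] expands after [k] steps; were the sign of [tau] wrong, [lam_cay] would
    make [lam] exceed [olam k = 1] there. *)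
Lemma tau_side (eps : R) k : eps ^+ 2 = 1 -> olam k = 1 ->
  (forall B, exists z, [/\ circle z, B < eps * complex.Im (cay y z)
                         & lam (N k) (orbit k z) <= 1]) ->
  0 <= eps * tau (N k) (orbit k y).
Proof.
move=> eps1 ok side; rewrite leNgt; apply/negP; rewrite /tau.
set i := complex.Im _; set r := complex.Re (mob_a (N k) * (mob_b (N k))^* * orbit k y).
move=> i0; have {}i0 : 0 < - (eps * i) by lra.
have m0 := mult_gt0 k.
(* If the coordinate of [z] exceeds this bound on the side [eps], then the one
   after [k] steps exceeds [`|r| / - (eps * i)], which makes the right-hand side
   of [lam_cay] positive. *)
have B0 : 0 <= (`|r| / - (eps * i) + `|drift k|) / mult k.
  by rewrite divr_ge0 ?addr_ge0 ?divr_ge0 // ltW.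
have [z [zC Bz lz]] := side ((`|r| / - (eps * i) + `|drift k|) / mult k).
have yz : y != z.
  apply: contraTneq Bz => <-.
  rewrite /cay subrr invr0 mulr0 [complex.Im _]/= mulr0 -leNgt //.
have yz' := orbit_inj k (circle_sqn_le1 yC) (circle_sqn_le1 zC) yz.
have := lam_cay (N k) (orbit_circle k yC) (orbit_circle k zC) yz'.
rewrite -/(olam k) ok -/r -/i.
have [_] := cay_orbit k (circle_sqn_le1 zC) yz => ->.
move: Bz; rewrite ltr_pdivrMr // => Bz.
have h1 : `|r| / - (eps * i) < eps * (mult k * complex.Im (cay y z) + drift k).
  have : - `|drift k| <= eps * drift k.
    have : `|eps * drift k| = `|drift k|.
      rewrite normrM; suff -> : `|eps| = 1 by rewrite mul1r.
      by apply/eqP; rewrite -(@eqrXn2 _ 2) // real_normK ?num_real // eps1 expr1n.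
    by move=> <-; have := ler_norm (- (eps * drift k)); rewrite normrN; lra.
  by move: Bz; lra.
move: h1; rewrite ltr_pdivrMr //.
move: (mult k * _ + _) => s h1 h2.
have h3 := ler_norm r.
have h4 : eps * s * - (eps * i) = - (s * i).
  by transitivity (- (eps ^+ 2 * (s * i))); [ring | rewrite eps1 mul1r].
have h5 : r + s * i < 0 by rewrite h4 in h1; lra.
have : (lam (N k) (orbit k z) - 1) * (1 + s ^+ 2) <= 0.
  by apply: mulr_le0_ge0; rewrite ?subr_le0 //; have := sqr_ge0 s; lra.
by rewrite h2; lra.
Qed.

(** If [mult] tends to zero, so does [y - p] by [orbit_center].  Otherwise the
    steps are eventually translations of one sign, with lengths bounded below,
    and [drift] diverges. *)
Theorem center_cvg (eps : R) (p : nat -> C) : eps ^+ 2 = 1 ->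
  (forall k, sqn (p k) < 1) -> (forall k, orbit k (p k) = 0) ->
  (forall k, olam k <= 1) ->
  (forall k B, exists z, [/\ circle z, B < eps * complex.Im (cay y z)
                         & lam (N k) (orbit k z) <= 1]) ->
  forall e : R, 0 < e -> exists K, forall k, (K <= k)%N -> sqn (p k - y) < e.
Proof.
move=> eps1 p1 p0 l1 side e e0.
have [m0|] := pselect (forall e : R, 0 < e -> exists k, mult k < e).
  exact: center_cvg_mult0 e0.
move=> /existsNP[L /not_implyP[L0 /forallNP hL]].
have {}hL k : L <= mult k by rewrite leNgt; apply/negP.
have [K hK] := olam_eventually1 l1 L0 hL.
have [d1 d10 hd1] := finite_gap (fun i => sqn (mob_b (h i))).
have t0 : 0 < 2 * Num.sqrt d1 by rewrite mulr_gt0 // sqrtr_gt0.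
have tk k : (K <= k)%N -> 2 * Num.sqrt d1 <= eps * tau (N k) (orbit k y).
  move=> Kk; rewrite -ler_sqr ?nnegrE ?(ltW t0) ?(tau_side eps1 (hK _ Kk)) //.
  rewrite [X in _ <= X]exprMn eps1 mul1r (tau_sqr (orbit_circle k yC) (hK _ Kk)).
  rewrite exprMn sqr_sqrtr ?(ltW d10) //.
  have : d1 <= sqn (mob_b (N k)) by rewrite Nh; apply: hd1; rewrite -Nh sqn_gt0.
  lra.
have dk m : - (eps * drift K) + m%:R * (2 * Num.sqrt d1) <= - (eps * drift (K + m)%N).
  elim: m => [|m IH]; first by rewrite mul0r addr0 addn0.
  rewrite addnS /= hK ?leq_addr // mul1r -natr1 mulrDl mul1r.
  have := tk (K + m)%N (leq_addr _ _); lra.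
pose D := 1 + 4 / e; have D1 : 1 < D by rewrite ltrDl divr_gt0.
pose B := (D + `|eps * drift K|) / (2 * Num.sqrt d1).
have B0 : 0 <= B by rewrite divr_ge0 ?(ltW t0) // addr_ge0 //; lra.
exists (K + Num.bound B)%N => k Kk; rewrite sqnBC.
have := orbit_center (p1 k) (p0 k).
have : mult k <= 1.
  by apply: le_trans (mult_le l1 (leq0n k)) _; rewrite /mult big_ord0.
have hD : D <= - (eps * drift k).
  have -> : k = (K + (k - K))%N by rewrite subnKC // (leq_trans _ Kk) // leq_addr.
  apply: le_trans (dk _).
  have : B <= (k - K)%:R.
    apply: le_trans (ltW (archi_boundP B0)) _.
    by rewrite ler_nat leq_subRL // (leq_trans _ Kk) // leq_addr.
  rewrite /B ler_pdivrMr // => h1; have := ler_norm (eps * drift K); lra.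
have hD2 : 4 / e < drift k ^+ 2.
  have -> : drift k ^+ 2 = (- (eps * drift k)) ^+ 2 by rewrite sqrrN exprMn eps1 mul1r.
  apply: (@lt_le_trans _ _ D); first by rewrite ltrDr.
  by apply: (le_trans hD); rewrite expr2 ler_peMl //; lra.
have := mult_gt0 k; have := sqn_ge0 (y - p k).
move: (mult k) (sqn _) (drift k ^+ 2) hD2 => m s d; rewrite ltr_pdivrMr // => hd s0 m0 m1 hs.
have {}hs : s * (1 + d) <= 4 by apply: le_trans hs _; nra.
rewrite ltNge; apply/negP => es.
nra.
Qed.

End Orbit.

(** * Topology of the circle *)

Section CircleTopology.
Variable R : realType.
Local Notation C := (Cplx R).

Lemma cvg_ReIm (T : Type) (F : set_system T) {FF : Filter F} (f : T -> C) (l : C) :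
  complex.Re (f t) @[t --> F] --> complex.Re l ->
  complex.Im (f t) @[t --> F] --> complex.Im l ->
  f t @[t --> F] --> l.
Proof.
move=> hr hi P /nbhs_sqnP[e e0 eP].
have e2 : 0 < Num.min 1 (e / 2) by rewrite lt_min ltr01 divr_gt0.
move/cvgrPdist_lt : hr => /(_ _ e2) h1; move/cvgrPdist_lt : hi => /(_ _ e2) h2.
suff: \forall t \near F, sqn (f t - l) < e by apply: filterS => t; exact: eP.
apply: filterS2 h1 h2 => t; rewrite !lt_min => /andP[a1 a2] /andP[b1 b2].
move: a1 a2 b1 b2; rewrite /sqn.
case: (f t) => x1 x2; case: l {eP} => y1 y2 /= a1 a2 b1 b2.
have h x : `|x| < 1 -> `|x| < e / 2 -> x ^+ 2 < e / 2.
  move=> x1' x2'; rewrite -real_normK ?num_real //.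
  by apply: le_lt_trans x2'; rewrite expr2 ler_piMr // ltW.
have := h _ a1 a2; have := h _ b1 b2.
by rewrite -[x1 - y1]opprB -[x2 - y2]opprB !sqrrN; lra.
Qed.

Lemma expi_circle (t : R) : circle (expi t).
Proof. by apply/circleP; rewrite /sqn /= cos2Dsin2. Qed.

Lemma expi_cont : continuous (@expi R : R -> C).
Proof.
move=> t; apply: cvg_ReIm => /=; first exact: continuous_cos.
exact: continuous_sin.
Qed.

Lemma expi_surj (z : C) : circle z -> exists2 t : R, t \in `[- pi, pi] & expi t = z.
Proof.
move=> /circleP; case: z => x y; rewrite /sqn /= => xy.
have x1 : x \in `[(-1), 1].
  rewrite in_itv /= -ler_norml -(@ler_pXn2r _ 2) ?nnegrE //.
  by rewrite real_normK ?num_real // expr1n; have := sqr_ge0 y; lra.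
have [a0 api] : 0 <= acos x /\ acos x <= pi.
  by split; [apply: acos_ge0 | apply: acos_lepi]; move: x1; rewrite in_itv.
have ca : cos (acos x) = x by apply: acosK.
have sa : sin (acos x) = `|y|.
  rewrite sin_acos ?(itvP x1) // -sqrtr_sqr; congr Num.sqrt; lra.
have [y0|y0] := leP 0 y.
  exists (acos x).
    by rewrite in_itv /= api andbT; apply: le_trans a0; rewrite oppr_le0 pi_ge0.
  by rewrite /expi ca sa ger0_norm.
exists (- acos x).
  rewrite in_itv /= lerN2 api /=.
  by apply: le_trans (pi_ge0 R); rewrite oppr_le0.
by rewrite /expi cosN sinN ca sa ltr0_norm // opprK.
Qed.

Lemma circle_expiE : @circle R = @expi R @` `[- pi, pi].
Proof.
apply/seteqP; split => z.
  by move=> /expi_surj[t t1 <-]; exists t.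
by move=> [t _ <-]; exact: expi_circle.
Qed.

Lemma circle_compact : compact (@circle R).
Proof.
rewrite circle_expiE; apply: continuous_compact; last exact: segment_compact.
by apply: continuous_subspaceT; exact: expi_cont.
Qed.

Lemma circle_closed : closed (@circle R).
Proof. apply: compact_closed; [exact: norm_hausdorff | exact: circle_compact]. Qed.

Lemma expiD (s t : R) : expi (s + t) = expi s * expi t.
Proof.
apply/eqP; rewrite /expi cosD sinD eq_complex /=.
by apply/andP; split; apply/eqP; ring.
Qed.

Lemma expi_chord (r t : R) : sqn (expi (r + t) - expi r) = 2 - 2 * cos t.
Proof.
rewrite expiD -{2}[expi r]mulr1 -mulrBr sqnM (circleP _).1; last exact: expi_circle.
rewrite mul1r /sqn /= subr0; have := cos2Dsin2 t; lra.
Qed.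

(** The chord is an increasing function of the angle on [0, pi], so points that
    are close on the circle have close arguments. *)
Lemma expi_near (d r : R) (z : C) : 0 < d <= pi -> circle z ->
  sqn (z - expi r) < 2 - 2 * cos d -> exists2 r', `|r' - r| < d & expi r' = z.
Proof.
move=> /andP[d0 dpi] zC zr.
have wC : circle (z * expi (- r)).
  by apply/circleP; rewrite sqnM (circleP _).1 // (circleP _).1 ?mulr1 //; exact: expi_circle.
have [t tpi tE] := expi_surj wC.
have zE : expi (r + t) = z.
  rewrite expiD tE mulrCA -expiD subrr /expi cos0 sin0.
  by rewrite -[RHS]mulr1.
exists (r + t) => //; rewrite addrAC subrr add0r.
move: zr; rewrite -zE expi_chord.
have tpi' : `|t| \in `[0, pi] by rewrite in_itv /= normr_ge0 ler_norml; move: tpi; rewrite in_itv.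
rewrite -(cos_norm t).
rewrite ltrD2l ltrN2 ltr_pM2l // ltr_cos // in_itv /= (ltW d0) dpi //.
Qed.

(** Openness relative to the circle, with squared moduli. *)
Definition rel_open (U : set C) := U `<=` @circle R /\
  forall z, U z -> exists2 e : R, 0 < e & forall z', circle z' -> sqn (z' - z) < e -> U z'.

Lemma arc_open (s t : R) : rel_open (Defs.arc s t).
Proof.
split=> [z [r _ <-]|z [r rst <-]]; first exact: expi_circle.
move: rst; rewrite /= in_itv /= => /andP[sr rt].
pose d := Num.min pi (Num.min (r - s) (t - r)).
have d0 : 0 < d by rewrite !lt_min pi_gt0 !subr_gt0 sr rt.
have dpi : d <= pi by rewrite ge_min lexx.
exists (2 - 2 * cos d).
  rewrite subr_gt0 -[X in _ < X]mulr1 ltr_pM2l // -cos0 ltr_cos // in_itv /= ?lexx ?pi_ge0 //.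
  by rewrite ltW.
move=> z' z'C; have dd : 0 < d <= pi by rewrite d0.
move=> /(expi_near dd z'C) [r' r'r <-].
exists r' => //=; rewrite in_itv /=; move: r'r; rewrite !lt_min ltr_norml => /and3P[_].
rewrite !ltr_norml; lra.
Qed.

Lemma union_arcs_open (U : set C) : finite_union_of_arcs U -> rel_open U.
Proof.
move=> [s ->]; split=> [z [p _]|z [p ps pz]]; first by apply: (arc_open _ _).1.
have [e e0 h] := (arc_open _ _).2 _ pz.
by exists e => // z' z'C z'z; exists p => //; apply: h.
Qed.

Lemma circle_not_isolated (z : C) (e : R) : circle z -> 0 < e ->
  exists z', [/\ circle z', z' != z & sqn (z' - z) < e].
Proof.
move=> /expi_surj[r _ <-] e0.
have : \forall t \near (0:R)^'+, sqn (expi (r + t) - expi r) < e /\ 0 < t <= pi.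
  have h : cos t @[t --> (0:R)^'+] --> cos 0 by apply: cvg_at_right_filter; exact: continuous_cos.
  have e2 : 0 < e / 2 by rewrite divr_gt0.
  have {}h : \forall t \near (0:R)^'+, `|cos 0 - cos t| < e / 2 by move/cvgrPdist_lt : h; exact.
  near=> t; split.
    rewrite expi_chord; have : `|cos 0 - cos t| < e / 2 by near: t.
    rewrite cos0 ltr_norml; lra.
  apply/andP; split; near: t; first exact: nbhs_right_gt.
  by apply: nbhs_right_le; exact: pi_gt0.
move=> /filter_ex [t [te /andP[t0 tpi]]].
exists (expi (r + t)); split => //; first exact: expi_circle.
rewrite -subr_eq0 -sqn_eq0 expi_chord gt_eqF //.
rewrite subr_gt0 -[X in _ < X]mulr1 ltr_pM2l // -cos0.
by rewrite ltr_cos // in_itv /= ?lexx ?pi_ge0 ?tpi ?andbT // ltW.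
Unshelve. all: by end_near. Qed.

Lemma rel_open_preim (G : mobius R) (U : set C) : rel_open U ->
  rel_open [set z | circle z /\ U (G z)].
Proof.
move=> [_ oU]; split => [z []//|z [zC Uz]].
have [e e0 he] := oU _ Uz.
have /(_ [set y | sqn (y - G z) < e]) := @mob_cont R G z (den_neq0 G (circle_sqn_le1 zC)).
have h : nbhs (G z) [set y | sqn (y - G z) < e] by apply/nbhs_sqnP; exists e.
move=> /(_ h) /nbhs_sqnP[d d0 hd]; exists d => // z' z'C z'z; split => //.
by apply: he; [exact: mob_circle | exact: hd].
Qed.

Lemma rel_openI (U V : set C) : rel_open U -> rel_open V -> rel_open (U `&` V).
Proof.
move=> [UC oU] [_ oV]; split => [z [/UC]//|z [/oU[d d0 hd] /oV[e e0 he]]].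
exists (Num.min d e) => [|z' z'C]; first by rewrite lt_min d0.
by rewrite lt_min => /andP[h1 h2]; split; [exact: hd | exact: he].
Qed.

(** [|y - z| |T| = |y + z|] tends to 2 as [z] tends to [y], and the circle has
    no isolated point. *)
Lemma cay_unbounded (U : set C) y : rel_open U -> circle y -> closure U y ->
  forall B : R, exists2 z, U z & B < `|complex.Im (cay y z)|.
Proof.
move=> [UC oU] yC /closure_sqnP hy B.
(* As [|y + z|^2 = 4 - |y - z|^2], the coordinate exceeds [B] in modulus if and
   only if [|y - z|^2 < 4 / (1 + B^2)]. *)
have e0 : 0 < 4 / (1 + B ^+ 2) :> R by rewrite divr_gt0 //; have := sqr_ge0 B; lra.
have [z [Uz zy ze]] : exists z, [/\ U z, z != y & sqn (z - y) < 4 / (1 + B ^+ 2)].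
  have [z Uz zy] := hy _ e0; have [zy0|zy0] := eqVneq z y; last by exists z.
  have [d d0 hd] := oU y (eq_ind _ _ Uz _ zy0).
  have m0 : 0 < Num.min d (4 / (1 + B ^+ 2)) by rewrite lt_min d0.
  have [z' [z'C z'y]] := circle_not_isolated yC m0.
  by rewrite lt_min => /andP[h1 h2]; exists z'; split => //; exact: hd.
have zC := UC _ Uz; exists z => //.
rewrite eq_sym in zy; rewrite sqnBC in ze.
have := cay_sqn zy; have := cay_circle yC zC.
have -> : sqn (y + z) = 4 - sqn (y - z).
  move: yC zC => /circleP y1 /circleP z1.
  have : sqn (y + z) + sqn (y - z) = 2 * (sqn y + sqn z).
    by case: (y) => a b; case: (z) => c d; rewrite /sqn /=; ring.
  by rewrite y1 z1; lra.
have s0 : 0 < sqn (y - z) by rewrite sqn_gt0 subr_eq0.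
move: ze; rewrite ltr_pdivlMr; last by have := sqr_ge0 B; lra.
case: (cay y z) => p q /= h1 -> h2.
have sq : sqn (0 +i* q)%C = q ^+ 2 by rewrite /sqn /= expr0n add0r.
rewrite sq in h2.
apply: le_lt_trans (ler_norm B) _; rewrite -ltr_sqr ?nnegrE // !real_normK ?num_real //.
by rewrite -(ltr_pM2l s0) h2; lra.
Qed.

(** If the sets do not all accumulate at [y] from the positive side, then some
    [U m0] has bounded coordinates on that side, hence so has every later set;
    and the earlier ones contain these. *)
Lemma one_side (y : C) (U : nat -> set C) : circle y ->
  (forall m, rel_open (U m)) -> (forall m n, (m <= n)%N -> U n `<=` U m) ->
  (forall m, closure (U m) y) ->
  exists2 eps : R, eps ^+ 2 = 1 &
    forall m B, exists2 z, U m z & B < eps * complex.Im (cay y z).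
Proof.
move=> yC oU dU cU.
have [h|] := pselect (forall m B, exists2 z, U m z & B < complex.Im (cay y z)).
  exists 1; first by rewrite expr1n.
  by move=> m B; have [z Uz zB] := h m B; exists z => //; rewrite mul1r.
move=> /existsNP[m0 /existsNP[B0 h]].
exists (-1); first by rewrite sqrrN expr1n.
move=> m B.
have [z Uz] := cay_unbounded (oU (maxn m m0)) yC (cU _) (`|B| + `|B0|).
move=> hz; exists z; first by apply: dU Uz; exact: leq_maxl.
have : complex.Im (cay y z) <= B0.
  rewrite leNgt; apply/negP => hB; apply: h; exists z => //.
  by apply: dU Uz; exact: leq_maxr.
move: hz; have := ler_norm B; have := ler_norm B0; rewrite mulN1r.
have := normr_ge0 B; have := normr_ge0 B0.
by case: (ger0P (complex.Im (cay y z))); lra.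
Qed.

(** A cluster point of a sequence of elements of the successive sets. *)
Lemma nested_cluster (V : nat -> set C) : (forall m, V m `<=` @circle R) ->
  (forall m, V m !=set0) -> (forall m k, (m <= k)%N -> V k `<=` V m) ->
  exists y, forall m, closure (V m) y.
Proof.
move=> VC Vne dV; have /boolp.choice[z_ hz] := Vne.
have [|y [_ cly]] := @circle_compact (z_ @ \oo) _.
  by exists 0%N => // m _; apply: VC (hz m).
exists y => m B nB.
have : (z_ @ \oo) (V m) by exists m => // k /= mk; exact: dV (hz k).
by move=> hV; have [z [Vz Bz]] := cly _ _ hV nB; exists z.
Qed.

Lemma closure_nonempty (U : set C) y : closure U y -> U !=set0.
Proof. by move=> /(_ setT filterT)[z [Uz _]]; exists z. Qed.

End CircleTopology.

(** * Weak convergence to a Dirac measure *)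

Section Poisson.
Variable R : realType.
Local Notation C := (Cplx R).
Local Notation mu := (@lebesgue_measure R).

Lemma mob_expi_cont (G : mobius R) : continuous (fun t : R => G (expi t)).
Proof.
move=> t; have e : G z @[z --> expi t] --> G (expi t).
  by apply: mob_cont; apply: den_neq0; apply: circle_sqn_le1; exact: expi_circle.
exact: (cvg_comp _ _ (@expi_cont R t) e).
Qed.

Lemma lam_expi_cont (G : mobius R) : continuous (fun t : R => lam G (expi t)).
Proof.
suff -> : (fun t : R => lam G (expi t)) = (fun t => 1 + 2 * sqn (mob_b G) +
   2 * (complex.Re (mob_a G * (mob_b G)^*) * cos t
        - complex.Im (mob_a G * (mob_b G)^*) * sin t)).
  move=> t; apply: cvgD; first exact: cvg_cst.
  apply: cvgM; first exact: cvg_cst.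
  apply: cvgB; apply: cvgM; try exact: cvg_cst; [exact: continuous_cos|exact: continuous_sin].
apply/funext => t; rewrite lam_expand; last exact: expi_circle.
by congr (_ + _ * _); case: (mob_a G * _).
Qed.

(** The real part of [a * den G z] is [(lam G z + 1) / 2 > 0], so its argument
    along the circle is an arctangent, whose derivative is
    [(1 - 1 / lam) / 2].  As it is periodic, [1 / lam] has the same integral
    as 1. *)
Lemma poisson_integral (G : mobius R) :
  (\int[mu]_(t in `[0%R, (pi *+ 2)%R]) (((lam G (expi t))^-1)%:E) = (pi *+ 2)%:E)%E.
Proof.
have lpos t : 0 < lam G (expi t).
  by apply: lam_gt0; apply: circle_sqn_le1; exact: expi_circle.
pose p := complex.Re (mob_a G * (mob_b G)^*).
pose q := complex.Im (mob_a G * (mob_b G)^*).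
pose u (t : R) := sqn (mob_a G) + (p * cos t - q * sin t).
pose v (t : R) := p * sin t + q * cos t.
have lE t : lam G (expi t) = sqn (mob_a G) + sqn (mob_b G) + 2 * (p * cos t - q * sin t).
  rewrite lam_expand; last exact: expi_circle.
  have := mob_normalizedE G; rewrite /p /q.
  case: (mob_a G * _) => r s /=; lra.
have uE t : u t = (lam G (expi t) + 1) / 2.
  rewrite lE /u; have := mob_normalizedE G; lra.
have upos t : 0 < u t by rewrite uE; have := lpos t; lra.
have uv t : u t ^+ 2 + v t ^+ 2 = sqn (mob_a G) * lam G (expi t).
  have e1 : p ^+ 2 + q ^+ 2 = sqn (mob_a G) * sqn (mob_b G).
    by rewrite -[p ^+ 2 + q ^+ 2]/(sqn _) sqnM sqnJ.
  have e2 := cos2Dsin2 t; rewrite lE /u /v.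
  transitivity (sqn (mob_a G) ^+ 2 + 2 * sqn (mob_a G) * (p * cos t - q * sin t)
     + (p ^+ 2 + q ^+ 2) * (cos t ^+ 2 + sin t ^+ 2)); first by ring.
  by rewrite e1 e2; ring.
pose F (t : R) := t - 2 * atan (v t / u t).
have dF (t : R) : is_derive t 1 F ((lam G (expi t))^-1).
  have du : is_derive t 1 u (- v t).
    rewrite /u; apply: is_derive_eq; rewrite /v /GRing.scale /=; ring.
  have dv : is_derive t 1 v (u t - sqn (mob_a G)).
    rewrite /v; apply: is_derive_eq; rewrite /u /GRing.scale /=; ring.
  pose r (s : R) : R := v s / u s.
  have dui := @is_deriveV _ u t (- v t) 1 (lt0r_neq0 (upos t)) du.
  have dvu : is_derive t 1 r
      (v t * (- (u t) ^- 2 * - v t) + (u t)^-1 * (u t - sqn (mob_a G))).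
    exact: (is_deriveM dv dui).
  have da : is_derive t 1 (atan \o r) _ := is_derive1_comp (is_derive1_atan (r t)) dvu.
  have dF := is_deriveB (is_derive_id t 1) (is_deriveZ 2 da).
  apply: (is_derive_eq dF).
  rewrite /GRing.scale /= /r.
  have := uv t; have u0 := lt0r_neq0 (upos t); have l0 := lt0r_neq0 (lpos t).
  have a0 : sqn (mob_a G) != 0 by rewrite sqn_eq0 mob_a_neq0.
  have := uE t; move: (u t) (v t) (lam _ _) (sqn (mob_a G)) u0 l0 a0 => a b l c a0 l0 c0 e1 e2.
  have s0 : 0 < a ^+ 2 + b ^+ 2.
    have := sqr_ge0 b; have : 0 < a ^+ 2 by rewrite exprn_even_gt0.
    lra.
  have -> : (1 + (b / a) ^+ 2)^-1 * (b * (- a ^- 2 * - b) + a^-1 * (a - c)) =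
     (a ^+ 2 + b ^+ 2 - c * a) / (a ^+ 2 + b ^+ 2).
    field; rewrite a0 /= andbT; first by rewrite gt_eqF.
  rewrite e2 e1; by field; rewrite l0.
rewrite (continuous_FTC2 (F := F) (twopi_gt0 R)).
- have vu : v (pi *+ 2) / u (pi *+ 2) = v 0 / u 0.
    by rewrite /v /u -[pi *+ 2]add0r cosD2pi sinD2pi.
  by rewrite /F vu -EFinB; congr (_%:E); ring.
- apply: continuous_subspaceT => t; apply: cvgV; first by rewrite gt_eqF.
  exact: lam_expi_cont.
- have cF t : F x @[x --> t] --> F t.
    by apply: differentiable_continuous; apply/derivable1_diffP; case: (dF t).
  split => [t _||]; first by case: (dF t).
    exact: cvg_at_right_filter.
  exact: cvg_at_left_filter.
- by move=> t _; rewrite derive1E; case: (dF t).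
Qed.

Lemma measurable_circle : measurable (@circle R : set (borelC R)).
Proof.
rewrite -[X in measurable X]setCK; apply: measurableC; apply: sub_sigma_algebra.
by apply: closed_openC; exact: circle_closed.
Qed.

(** Composed with [expi] a Möbius map is continuous on the whole line, which
    gives measurability without looking at its pole. *)
Lemma measurable_borelC (g : R -> C) : continuous g ->
  measurable_fun [set: R] (g : R -> borelC R).
Proof.
move=> /continuousP cg; apply: (@measurability _ _ _ (borelC R) _ _ (@open C)) => //.
move=> _ [U oU <-]; rewrite setTI; apply: open_measurable; exact: cg.
Qed.

Lemma measurable_within_circle (f : C -> R) : {within @circle R, continuous f} ->
  measurable_fun (@circle R : set (borelC R)) (f : borelC R -> R).
Proof.
move=> /continuousP cf; apply: (measurability _ (RGenOpens.measurableE R)).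
move=> _ [_ [a [b ->] <-]].
have oab : open (`]a, b[%classic : set R) by exact: interval_open.
have /open_subspaceP[V oV VE] := cf _ oab.
rewrite setIC -VE; apply: measurableI; last exact: measurable_circle.
exact: sub_sigma_algebra.
Qed.

Lemma bounded_circle (f : C -> R) : {within @circle R, continuous f} ->
  exists2 M, 0 < M & forall z, circle z -> `|f z| <= M.
Proof.
move=> cf; have := continuous_compact cf (@circle_compact R).
move=> /compact_bounded [M [_ hM]].
exists (`|M| + 1) => [|z zC]; first by rewrite ltr_wpDl.
by apply: (hM (`|M| + 1)); [rewrite (le_lt_trans (ler_norm M)) // ltrDl | exists z].
Qed.

Local Notation P := (uniform_prob (twopi_gt0 R)).

Lemma bounded_uniform_integrable (u : R -> R) (M : R) : measurable_fun [set: R] u ->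
  (forall t, `|u t| <= M) -> P.-integrable [set: R] (EFin \o u).
Proof.
move=> mu' uM; apply: measurable_bounded_integrable => //.
- by have := @probability_setT _ _ R P; move=> /= ->; rewrite ltry.
- exists M; split; first by rewrite num_real.
  by move=> x Mx t _ /=; apply: le_trans (uM t) (ltW Mx).
Qed.

(** [f] is only controlled on the circle, so it is replaced by zero elsewhere
    before the change of variables. *)
Lemma integral_circle_push (G : mobius R) (f : C -> R) :
  {within @circle R, continuous f} ->
  (\int[pushforward (@uniform_circle R)
      (G : borelC R -> borelC R)]_(z in @circle R) (f z)%:E
   = \int[P]_t (f (G (expi t)))%:E)%E.
Proof.
move=> cf.
have mphi : measurable_fun [set: R] (fun t => G (expi t) : borelC R).
  by apply: measurable_borelC; exact: mob_expi_cont.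
have phiC : (fun t => G (expi t) : borelC R) @^-1` (@circle R) = setT.
  by apply/seteqP; split => // t _; apply: mob_circle; exact: expi_circle.
have mf := measurable_within_circle cf.
have [M M0 fM] := bounded_circle cf.
pose phi (t : R) : borelC R := G (expi t).
transitivity (\int[pushforward P phi]_(z in @circle R) (f z)%:E)%E; first by [].
have mg : measurable_fun [set: borelC R]
    ((fun z => (f z)%:E) \_ (@circle R) : borelC R -> \bar R).
  apply/(measurable_restrictT _ measurable_circle).
  exact/measurable_EFinP.
have gphi : ((fun z => (f z)%:E) \_ (@circle R) : borelC R -> \bar R) \o
      (fun t => G (expi t))
    = EFin \o (fun t => f (G (expi t))).
  by apply/funext => t; rewrite /= patchE mem_set //; apply: mob_circle; exact: expi_circle.
have mu' : measurable_fun [set: R] (fun t => f (G (expi t))).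
  apply/measurable_EFinP.
  rewrite -[X in measurable_fun _ X]/(EFin \o (fun t => f (G (expi t)))) -gphi.
  exact: measurableT_comp mg mphi.
have iu : P.-integrable (phi @^-1` (@circle R))
   (((fun z => (f z)%:E) \_ (@circle R) : borelC R -> \bar R) \o phi).
  rewrite phiC gphi; apply: (bounded_uniform_integrable mu' (M := M)) => t.
  by apply: fM; apply: mob_circle; exact: expi_circle.
have mk : (\int[pushforward P phi]_(z in @circle R) (f z)%:E =
   \int[pushforward P phi]_z ((fun z => (f z)%:E) \_ (@circle R) : borelC R -> \bar R) z)%E.
  by rewrite /integral unlock /= patch_setT.
have iu2 : P.-integrable (phi @^-1` setT)
   (((fun z => (f z)%:E) \_ (@circle R) : borelC R -> \bar R) \o phi).
  by rewrite preimage_setT -phiC.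
rewrite mk.
rewrite (@integral_pushforward _ _ (measurableTypeR R) (borelC R) R phi mphi P setT
  _ mg iu2 measurableT).
by rewrite preimage_setT gphi.
Qed.

Lemma mean_inv_lam (G : mobius R) :
  (\int[P]_t ((lam G (expi t))^-1)%:E = 1)%E.
Proof.
rewrite integral_uniform.
- rewrite poisson_integral subr0 -EFinM mulVf //.
  by rewrite gt_eqF // twopi_gt0.
- apply/measurable_EFinP; apply: continuous_measurable_fun => t.
  apply: cvgV; last exact: lam_expi_cont.
  by rewrite gt_eqF //; apply: lam_gt0; apply: circle_sqn_le1; exact: expi_circle.
- move=> t; rewrite lee_fin invr_ge0 ltW //.
  by apply: lam_gt0; apply: circle_sqn_le1; exact: expi_circle.
Qed.

Lemma integrable_inv_lam (G : mobius R) :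
  P.-integrable [set: R] (EFin \o (fun t => (lam G (expi t))^-1)).
Proof.
have l0 t : 0 < lam G (expi t).
  by apply: lam_gt0; apply: circle_sqn_le1; exact: expi_circle.
apply/integrableP; split.
  apply/measurable_EFinP; apply: continuous_measurable_fun => t.
  by apply: cvgV; [rewrite gt_eqF | exact: lam_expi_cont].
suff -> : (\int[P]_t `|(EFin \o (fun t : R => (lam G (expi t))^-1%R)) t| =
    \int[P]_t ((lam G (expi t))^-1)%:E)%E by rewrite mean_inv_lam ltry.
by apply: eq_integral => t _ /=; rewrite ger0_norm // invr_ge0 ltW.
Qed.

(** Chebyshev's inequality: the mean of [|G z - G 0|^2] is [1 - |G 0|^2], since
    [|G z - G 0|^2 = (1 - |G 0|^2) / lam G z] by [mob_dist]. *)
Lemma integral_near_center (G : mobius R) (f : C -> R) (y : C) (e K : R) :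
  {within @circle R, continuous f} -> 0 <= e -> 0 <= K ->
  (forall z, circle z -> `|f z - f y| <= e + K * sqn (z - y)) ->
  exists2 I : R, (\int[P]_t (f (G (expi t)))%:E = I%:E)%E &
    `|I - f y| <= e + 2 * K * (sqn (G 0 - y) + (1 - sqn (G 0))).
Proof.
move=> cf e0 K0 hf.
have sC t : circle (G (expi t)) by apply: mob_circle; exact: expi_circle.
have mu : measurable_fun [set: R] (fun t => f (G (expi t))).
  have mphi : measurable_fun [set: R] (fun t => G (expi t) : borelC R).
    by apply: measurable_borelC; exact: mob_expi_cont.
  apply: (measurable_comp measurable_circle _ (measurable_within_circle cf) mphi).
  by move=> _ [t _ <-].
have [M M0 fM] := bounded_circle cf.
have iu : P.-integrable [set: R] (EFin \o (fun t => f (G (expi t)))).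
  by apply: (bounded_uniform_integrable mu (M := M)) => t; exact: fM.
have ic (c : R) : P.-integrable [set: R] (EFin \o cst c).
  exact: (bounded_uniform_integrable (measurable_cst c) (M := `|c|)).
pose k := 1 - sqn (G 0).
exists (\int[P]_t (f (G (expi t))))%R.
  by rewrite /Rintegral fineK //; exact: integrable_fin_num.
have P1 : fine (P [set: R]) = 1 by rewrite (@probability_setT _ _ R P).
have -> : \int[P]_t f (G (expi t)) - f y = \int[P]_t (f (G (expi t)) - f y).
  rewrite RintegralB //; last exact: ic.
  by rewrite Rintegral_cst // P1 mulr1.
have iuc : P.-integrable [set: R] (EFin \o (fun t => f (G (expi t)) - f y)).
  exact: (integrableB measurableT iu (ic (f y))).
apply: le_trans (le_normr_Rintegral measurableT iuc) _.
have iw : P.-integrable [set: R] (EFin \o (fun t => (e + 2 * K * sqn (G 0 - y)) +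
    2 * K * k * (lam G (expi t))^-1)).
  have := integrableD measurableT (ic (e + 2 * K * sqn (G 0 - y)))
    (integrableZl measurableT (2 * K * k) (integrable_inv_lam G)).
  exact.
apply: (@le_trans _ _ (\int[P]_t ((e + 2 * K * sqn (G 0 - y)) +
    2 * K * k * (lam G (expi t))^-1))%R).
  apply: le_Rintegral => //; first exact: (integrable_norm iuc).
  move=> t _; apply: le_trans (hf _ (sC t)) _.
  have -> : G (expi t) - y = (G (expi t) - G 0) + (G 0 - y) by rewrite addrA subrK.
  have c0 : sqn (0 : C) <= 1 by rewrite sqn0.
  have d : sqn (G (expi t) - G 0) = k * (lam G (expi t))^-1.
    rewrite mob_dist //; last exact: circle_sqn_le1 (expi_circle t).
    rewrite /k mob_onem_sqn // subr0 (circleP _).1; last exact: expi_circle.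
    by rewrite sqn0 subr0 !mul1r invfM mulrC.
  have := sqnD_le (G (expi t) - G 0) (G 0 - y); rewrite d => h.
  have := ler_wpM2l K0 h; lra.
rewrite RintegralD //; first last.
- exact: (integrableZl measurableT _ (integrable_inv_lam G)).
- exact: ic.
rewrite Rintegral_cst // P1 mulr1 RintegralZl //; last exact: integrable_inv_lam.
have -> : \int[P]_t (lam G (expi t))^-1 = 1 by rewrite /Rintegral mean_inv_lam.
by rewrite /k; lra.
Qed.

Lemma circle_continuous_at (f : C -> R) (y : C) (e : R) :
  {within @circle R, continuous f} -> circle y -> 0 < e ->
  exists2 d : R, 0 < d & forall z, circle z -> sqn (z - y) < d -> `|f z - f y| < e.
Proof.
move=> cf yC e0.
have := cf y; rewrite /continuous_at => /cvgrPdist_lt /(_ _ e0).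
rewrite /nbhs /= -nbhs_subspace_in // => /nbhs_sqnP[d d0 hd].
by exists d => // z zC zd; rewrite distrC; exact: hd.
Qed.

Lemma onem_sqn_le (g y : C) : sqn g <= 1 -> circle y -> (1 - sqn g) ^+ 2 <= 4 * sqn (g - y).
Proof.
move=> g1 /circleP y1.
have h : (1 - sqn g) ^+ 2 <= sqn (g - y) * sqn (g + y).
  rewrite -y1; case: g {g1} => a b; case: y {y1} => c d; rewrite /sqn /= -subr_ge0.
  apply: (@le_trans _ _ (((a - c) * (b + d) - (b - d) * (a + c)) ^+ 2)).
    exact: sqr_ge0.
  by rewrite le_eqVlt; apply/orP; left; apply/eqP; ring.
have h2 : sqn (g + y) <= 4.
  by apply: le_trans (sqnD_le _ _) _; rewrite y1; lra.
by apply: le_trans h _; rewrite mulrC ler_wpM2r // sqn_ge0.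
Qed.

Lemma integral_dirac_circle (f : C -> R) (x : C) :
  {within @circle R, continuous f} -> circle x ->
  (\int[\d_(x : borelC R)]_(z in @circle R) (f z)%:E = (f x)%:E)%E.
Proof.
move=> cf xC.
have mf : measurable_fun (@circle R : set (borelC R)) (fun z : borelC R => (f z)%:E).
  by apply/measurable_EFinP; exact: measurable_within_circle.
by rewrite (integral_dirac (x : borelC R) measurable_circle mf) diracE mem_set // mul1e.
Qed.

(** A continuous [f] satisfies [|f z - f y| <= e + Q |z - y|^2] on the circle, for
    every [e > 0] and a suitable [Q]. *)
Theorem represents_of_center (G : nat -> mobius R) (y : C) : circle y ->
  (forall e : R, 0 < e -> exists K, forall k, (K <= k)%N -> sqn (G k 0 - y) < e) ->
  represents G y.
Proof.
move=> yC hG; split => // f cf.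
have c0 : sqn (0 : C) <= 1 by rewrite sqn0.
rewrite integral_dirac_circle //.
have -> : (fun n => \int[pushforward (@uniform_circle R)
    (G n : borelC R -> borelC R)]_(z in @circle R) (f z)%:E)%E
  = (fun n => \int[P]_t (f (G n (expi t)))%:E)%E.
  by apply/funext => n; exact: integral_circle_push.
have [M M0 fM] := bounded_circle cf.
suff key : forall e : R, 0 < e -> exists K, forall k, (K <= k)%N -> 
  exists2 I : R, (\int[P]_t (f (G k (expi t)))%:E = I%:E)%E & `|I - f y| < e.
  apply: cvg_EFin.
    have [K hK] := key 1 ltr01; exists K => // k /= /hK [I -> _] //.
  apply/cvgrPdist_lt => e e0; have [K hK] := key e e0.
  by exists K => // k /= /hK [I -> hI]; rewrite distrC.
move=> e e0.
have e2 : 0 < e / 2 by rewrite divr_gt0.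
have [d d0 hd] := circle_continuous_at cf yC e2.
pose Q : R := 2 * M / d; have Q0 : 0 < Q by rewrite divr_gt0 ?mulr_gt0.
have hQ z : circle z -> `|f z - f y| <= e / 2 + Q * sqn (z - y).
  move=> zC; have s0 := sqn_ge0 (z - y).
  have [zd|zd] := ltP (sqn (z - y)) d.
    by apply: le_trans (ltW (hd z zC zd)) _; rewrite lerDl mulr_ge0 // ltW.
  have : `|f z - f y| <= 2 * M.
    by apply: le_trans (ler_normB _ _) _; have := fM _ zC; have := fM _ yC; lra.
  have : 2 * M <= Q * sqn (z - y).
    by rewrite /Q mulrAC ler_pdivlMr // ler_pM2l ?mulr_gt0.
  lra.
pose h : R := e / (9 * Q); have h0 : 0 < h by rewrite divr_gt0 // mulr_gt0.
have hm : 0 < Num.min h (h ^+ 2 / 4) by rewrite lt_min h0 divr_gt0 ?exprn_gt0.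
have [K hK] := hG _ hm.
exists K => k /hK; rewrite lt_min => /andP[k1 k2].
have [I IE hI] := integral_near_center (G k) cf (ltW e2) (ltW Q0) hQ.
exists I => //; apply: le_lt_trans hI _.
have g1 : sqn (G k 0) <= 1 by apply: mob_le1.
have k3 : 1 - sqn (G k 0) < h.
  rewrite -ltr_sqr ?nnegrE ?subr_ge0 // ?(ltW h0) //.
  by apply: le_lt_trans (onem_sqn_le g1 yC) _; lra.
have : Q * h = e / 9 by rewrite /h; field; rewrite gt_eqF.
have : Q * (sqn (G k 0 - y) + (1 - sqn (G k 0))) < Q * (2 * h).
  by rewrite ltr_pM2l //; lra.
lra.
Qed.

Lemma Re_cont : continuous (@complex.Re R : C -> R).
Proof.
move=> z P /nbhs_ballP[e /= e0 eP]; apply/nbhs_sqnP.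
exists (e ^+ 2) => [|w]; first by rewrite exprn_gt0.
move=> wz; apply: eP; rewrite -ball_normE /=; move: wz.
case: z => a b; case: w => c d; rewrite /sqn /= => h.
rewrite -ltr_sqr ?nnegrE ?(ltW e0) // real_normK ?num_real //.
by apply: le_lt_trans h; rewrite -[a - c]opprB sqrrN lerDl sqr_ge0.
Qed.

Lemma Im_cont : continuous (@complex.Im R : C -> R).
Proof.
move=> z P /nbhs_ballP[e /= e0 eP]; apply/nbhs_sqnP.
exists (e ^+ 2) => [|w]; first by rewrite exprn_gt0.
move=> wz; apply: eP; rewrite -ball_normE /=; move: wz.
case: z => a b; case: w => c d; rewrite /sqn /= => h.
rewrite -ltr_sqr ?nnegrE ?(ltW e0) // real_normK ?num_real //.
by apply: le_lt_trans h; rewrite -[b - d]opprB sqrrN lerDr sqr_ge0.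
Qed.

(** The real and imaginary parts are test functions that separate points. *)
Lemma represents_unique (G : nat -> mobius R) (x y : C) :
  represents G x -> represents G y -> x = y.
Proof.
move=> [xC hx] [yC hy].
have key (f : C -> R) : continuous f -> f x = f y.
  move=> cf; have cf' : {within @circle R, continuous f} by exact: continuous_subspaceT.
  have := hx f cf'; have := hy f cf'; rewrite !integral_dirac_circle // => h1 h2.
  have : (f x)%:E = (f y)%:E by apply: cvg_unique h2 h1; exact: ereal_hausdorff.
  by case.
have := key _ Re_cont; have := key _ Im_cont.
by case: x {xC hx key} => a b; case: y {yC hy} => c d /= -> ->.
Qed.

End Poisson.

(** * Infinite words *)

Section InfWords.
Variable A : finType.
Implicit Types (w : infword A) (n : nat).

Lemma prefix_ofS w n : prefix_of w n.+1 = rcons (prefix_of w n) (w n).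
Proof. exact: mkseqS. Qed.

Lemma size_prefix_of w n : size (prefix_of w n) = n.
Proof. exact: size_mkseq. Qed.

Lemma prefix_ofD w m n :
  prefix_of w (m + n) = prefix_of w m ++ prefix_of (fun i => w (m + i)%N) n.
Proof.
elim: n => [|n IH]; first by rewrite addn0 cats0.
by rewrite addnS !prefix_ofS IH rcons_cat.
Qed.

Lemma take_prefix_of w m n : (m <= n)%N -> take m (prefix_of w n) = prefix_of w m.
Proof. by move=> mn; rewrite -(subnKC mn) prefix_ofD take_size_cat ?size_prefix_of. Qed.

Lemma cylinder_prefixP w w' n :
  cylinder (prefix_of w n) w' <-> prefix_of w' n = prefix_of w n.
Proof. by rewrite /cylinder /= size_prefix_of. Qed.

Lemma nbhs_cylinder w n : nbhs w (cylinder (prefix_of w n)).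
Proof.
suff : \forall w' \near w, prefix_of w' n = prefix_of w n.
  by apply: filterS => w' h; rewrite /cylinder /= size_prefix_of.
elim: n => [|n IH]; first by near=> w'.
have h : \forall w' \near w, w' n = w n.
  by apply: (@proj_continuous nat (fun=> discrete_topology A) n w [set w n]).
by apply: filterS2 IH h => w' e1 e2; rewrite !prefix_ofS e1 e2.
Unshelve. all: by end_near. Qed.

(** The sets that contain a cylinder around [w] form a filter which converges
    to [w] coordinatewise, hence in the product topology. *)
Lemma nbhs_cylinderP w (B : set (infword A)) :
  nbhs w B -> exists n, cylinder (prefix_of w n) `<=` B.
Proof.
pose F : set_system (infword A) := [set B | exists n, cylinder (prefix_of w n) `<=` B].
have cyl_mono m n : (m <= n)%N -> cylinder (prefix_of w n) `<=` cylinder (prefix_of w m).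
  move=> mn w' /cylinder_prefixP e; apply/cylinder_prefixP.
  by rewrite -(take_prefix_of w' mn) e take_prefix_of.
have FF : Filter F.
  split; first by exists 0%N.
  - move=> P Q [m mP] [n nQ]; exists (maxn m n) => w' hw; split.
      by apply: mP; apply: cyl_mono hw; exact: leq_maxl.
    by apply: nQ; apply: cyl_mono hw; exact: leq_maxr.
  - by move=> P Q PQ [m mP]; exists m; apply: subset_trans PQ.
suff : F --> w by apply.
apply/cvg_sup => i; apply/cvg_image.
  by rewrite predeqE => a; split => // _; exists (fun=> a).
move=> V; rewrite /nbhs /= => /principal_filterP Vwi.
exists ((fun w' : infword A => w' i) @^-1` V).
  exists i.+1 => w' /cylinder_prefixP; rewrite !prefix_ofS => /rcons_inj[_ e].
  by rewrite /preimage /= e.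
rewrite predeqE => a; split => [[w' Vw' <-]//|Va].
by exists (fun=> a).
Qed.

Lemma closed_cylinder (S : set (infword A)) w : closed S ->
  (forall n, exists2 w', S w' & prefix_of w' n = prefix_of w n) -> S w.
Proof.
move=> cS h; apply: cS => B /nbhs_cylinderP[n nB].
by have [w' Sw' e] := h n; exists w'; split => //; apply: nB; apply/cylinder_prefixP.
Qed.

Lemma subshift_tail (S : set (infword A)) w k : subshift S -> S w ->
  S (fun i => w (k + i)%N).
Proof.
move=> [_ sS] Sw; elim: k => [|k IH].
  by rewrite (_ : (fun i => _) = w) //; apply/funext => i.
apply: sS; exists (fun i => w (k + i)%N) => //.
by apply/funext => i; rewrite /shift_word addnS.
Qed.

Lemma language_prefix (S : set (infword A)) (v : seq A) : subshift S ->
  language S v <-> exists2 w, S w & prefix_of w (size v) = v.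
Proof.
move=> sS; split=> [[w Sw [k vE]]|[w Sw vE]].
  exists (fun i => w (k + i)%N); first exact: (subshift_tail k sS Sw).
  exact: esym vE.
by exists w; [exact: Sw | exists 0%N; exact: esym vE].
Qed.

Lemma language_block (S : set (infword A)) w k n : S w ->
  language S (prefix_of (fun i => w (k + i)%N) n).
Proof. by move=> Sw; exists w => //; exists k; rewrite size_mkseq. Qed.

Lemma language_take (S : set (infword A)) (v : seq A) n : subshift S ->
  language S v -> language S (take n v).
Proof.
move=> sS /(language_prefix v sS)[w Sw vE]; apply/(language_prefix _ sS).
exists w => //; rewrite size_take -[in RHS]vE.
case: ltnP => nv; first by rewrite take_prefix_of // ltnW.
by rewrite vE take_oversize.
Qed.

End InfWords.

(** * Refined sets *)

Section Refined.
Variables (R : realType) (A : finType) (F : A -> mobius R).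
Local Notation C := (Cplx R).
Variable W : A -> set C.
Hypothesis Wopen : forall a, rel_open (W a).

Definition iword (u : seq A) : mobius R := mob_inv (word_mob F u).

Lemma word_mob_cat u v z : sqn z <= 1 ->
  word_mob F (u ++ v) z = word_mob F u (word_mob F v z).
Proof.
move=> z1; elim: u => [|a u IH]; first by rewrite /= mob_idE.
rewrite cat_cons /= !mob_compE ?norm_le1P ?IH //; exact: mob_le1.
Qed.

Lemma iwordK u z : sqn z <= 1 -> word_mob F u (iword u z) = z.
Proof. exact: mob_cancel_inv. Qed.

Lemma word_mobK u z : sqn z <= 1 -> iword u (word_mob F u z) = z.
Proof. exact: mob_inv_cancel. Qed.

Lemma iword_cat u v z : sqn z <= 1 -> iword (u ++ v) z = iword v (iword u z).
Proof.
move=> z1; have h1 := mob_le1 (iword u) z1; have h2 := mob_le1 (iword v) h1.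
by rewrite -[in LHS](iwordK u z1) -[in LHS](iwordK v h1) -word_mob_cat // word_mobK.
Qed.

Lemma iword0 z : iword [::] z = z.
Proof.
rewrite /iword /mob_fun /= conjC1 oppr0 addr0 mul1r.
by rewrite conjC0 mul0r add0r conjC1 divr1.
Qed.

(** The default value of [nth] must be quantified over, [A] being possibly
    empty. *)
Lemma refinedP u z : refined F W u z <->
  circle z /\ forall i a, (i < size u)%N -> W (nth a u i) (iword (take i u) z).
Proof.
split.
- move=> [zC h]; split => // i a iu.
  have [y Wy yE] := h (Ordinal iu) I.
  have y1 : sqn y <= 1 by apply: circle_sqn_le1; apply: (Wopen _).1 Wy.
  by move: Wy; rewrite -yE word_mobK // (tnth_nth a).
- move=> [zC h]; split => // i _.
  have z1 := circle_sqn_le1 zC.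
  exists (iword (take i u) z); last exact: iwordK.
  by rewrite (tnth_nth (tnth (in_tuple u) i)); apply: h.
Qed.

Lemma refined_circle u : refined F W u `<=` @circle R.
Proof. by move=> z []. Qed.

(** The cocycle property that lets the shift act on refined sets. *)
Lemma refined_cat u v z : refined F W (u ++ v) z <->
  refined F W u z /\ refined F W v (iword u z).
Proof.
split.
- move=> /refinedP[zC h]; have z1 := circle_sqn_le1 zC; split; apply/refinedP; split => //.
  + move=> i a iu; have := h i a; rewrite size_cat nth_cat take_cat iu.
    by apply; rewrite ltn_addr.
  + exact: mob_circle.
  + move=> i a iv; have := h (size u + i)%N a.
    rewrite size_cat nth_cat take_cat ltn_add2l iv [(size u + i < size u)%N]ltnNge.
    by rewrite leq_addr /= addKn iword_cat //; apply.
- move=> [/refinedP[zC hu] /refinedP[_ hv]]; apply/refinedP; split => // i a.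
  rewrite size_cat nth_cat take_cat.
  case: (ltnP i (size u)) => iu; first by move=> _; exact: hu.
  move=> iv; rewrite iword_cat ?circle_sqn_le1 //; apply: hv.
  by rewrite ltn_subLR.
Qed.

Lemma refined_take u n : refined F W u `<=` refined F W (take n u).
Proof. by move=> z; rewrite -{1}(cat_take_drop n u) => /refined_cat[]. Qed.

Lemma refined0 : refined F W [::] = @circle R.
Proof. by apply/seteqP; split => z; [case | move=> zC; apply/refinedP; split]. Qed.

Lemma refined_open u : rel_open (refined F W u).
Proof.
elim/last_ind: u => [|u a IH].
  by rewrite refined0; split => // z _; exists 1.
rewrite (_ : refined F W (rcons u a) =
    refined F W u `&` [set z | circle z /\ W a (iword u z)]).
  by apply: rel_openI => //; exact: rel_open_preim.
apply/seteqP; split => z; rewrite -cats1.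
- move=> /refined_cat[hu /refinedP[_ /(_ 0%N a isT) h]]; split => //; split.
    exact: refined_circle hu.
  by move: h; rewrite /= iword0.
- move=> [hu [zC Wz]]; apply/refined_cat; split => //; apply/refinedP; split.
    exact: mob_circle.
  by case=> // b _; rewrite /= iword0.
Qed.

Lemma closure_refined_circle u : closure (refined F W u) `<=` @circle R.
Proof.
move=> z hz; apply: (@circle_closed R).
exact: (closure_subset (@refined_circle u)) hz.
Qed.

Lemma closure_refined_take u n :
  closure (refined F W u) `<=` closure (refined F W (take n u)).
Proof. by apply: closure_subset; exact: refined_take. Qed.

Lemma closure_refined_cat u v y : closure (refined F W (u ++ v)) y ->
  closure (refined F W v) (iword u y).
Proof.
move=> hy; have yC := closure_refined_circle hy.
have c := @mob_cont R (iword u) y (den_neq0 _ (circle_sqn_le1 yC)).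
move=> B /c hB; have [z [/refined_cat[_ hz] Bz]] := hy _ hB.
by exists (iword u z).
Qed.

(** * The interval shift as a number system *)

Variable S : set (infword A).
Hypothesis sS : subshift S.
Hypothesis comp : compatible F W S.

Local Notation Sigma := (interval_shift F W S).

Lemma interval_shift_subshift : subshift Sigma.
Proof.
split.
- move=> w cw; split.
    apply: sS.1; apply: closure_subset cw; by move=> ? [].
  move=> n; have [w' [[_ h] /cylinder_prefixP e]] := cw _ (nbhs_cylinder w n).
  by rewrite -e.
- move=> _ [w [Sw h] <-]; split; first by apply: sS.2; exists w.
  move=> n; have [z] := h n.+1.
  rewrite -add1n prefix_ofD => /refined_cat[_ hz].
  by exists (iword (prefix_of w 1) z).
Qed.

(** Compatibility extends [v] one letter at a time while keeping [y] in the
    closure; the resulting word is in [S] because [S] is closed. *)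
Lemma point_extension v y : language S v -> closure (refined F W v) y ->
  exists2 w, Sigma w & prefix_of w (size v) = v /\
    forall n, closure (refined F W (prefix_of w n)) y.
Proof.
move=> Lv cv; pose good u := language S u /\ closure (refined F W u) y.
have [[w0 Sw0] hc] := comp.
(* A letter must be provided for the words that cannot be extended, too. *)
have /boolp.choice[next hnext] : forall u, exists a, good u -> good (rcons u a).
  move=> u; have [[Lu cu]|ng] := pselect (good u); last by exists (w0 0%N).
  have := cu; rewrite hc // => -[a La ca]; by exists a.
pose V := fix V k := if k is k'.+1 then rcons (V k') (next (V k')) else v.
have gV k : good (V k) by elim: k => [//|k IH] /=; exact: hnext.
have sV k : size (V k) = (size v + k)%N.
  by elim: k => [|k IH] /=; rewrite ?addn0 // size_rcons IH addnS.
have tV j k : (j <= k)%N -> take (size (V j)) (V k) = V j.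
  elim: k => [|k IH]; first by rewrite leqn0 => /eqP ->; rewrite take_size.
  rewrite leq_eqVlt => /orP[/eqP ->|jk]; first by rewrite take_size.
  rewrite /= -cats1 takel_cat ?IH //.
  by rewrite !sV leq_add2l.
pose w : infword A := fun i => nth (w0 0%N) (V i.+1) i.
have wV n : prefix_of w n = take n (V n).
  apply: (@eq_from_nth _ (w0 0%N)) => [|i].
    by rewrite size_prefix_of size_takel // sV leq_addl.
  rewrite size_prefix_of => iN; rewrite nth_mkseq // nth_take //.
  rewrite /w -(tV i.+1 n iN) nth_take // sV.
  by rewrite addnS ltnS leq_addl.
have cw n : closure (refined F W (prefix_of w n)) y.
  by rewrite wV; apply: closure_refined_take; case: (gV n).
exists w; last first.
  split => //; rewrite wV.
  by rewrite -[X in take X _]/(size (V 0%N)) tV.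
split; last by move=> n; exact: closure_nonempty (cw n).
apply: (closed_cylinder sS.1) => n.
have /(language_prefix _ sS)[w' Sw' e] : language S (prefix_of w n).
  by rewrite wV; apply: language_take => //; case: (gV n).
by exists w' => //; rewrite size_prefix_of in e.
Qed.

Variable n : nat.
Hypothesis n1 : (1 <= n)%N.
Hypothesis expand : forall u, language Sigma u -> size u = n ->
  (forall x, closure (refined F W u) x -> lam (iword u) x <= 1) /\
  mob_b (word_mob F u) != 0.

(** Only the prefixes whose length is a multiple of [n] are products of block
    maps, to which [center_cvg] applies. *)
Lemma center_blocks w y : Sigma w ->
  (forall m, closure (refined F W (prefix_of w m)) y) ->
  forall e : R, 0 < e -> exists K, forall k, (K <= k)%N ->
    sqn (word_mob F (prefix_of w (k * n)) 0 - y) < e.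
Proof.
move=> Sw cy.
have yC : circle y := closure_refined_circle (cy 0%N).
have y1 := circle_sqn_le1 yC.
pose block k := prefix_of (fun i => w (k * n + i)%N) n.
have block_size k : size (block k) == n by rewrite size_prefix_of.
have prefS k : prefix_of w (k.+1 * n) = prefix_of w (k * n) ++ block k.
  by rewrite mulSn addnC prefix_ofD.
have Lblock k : language Sigma (block k) by apply: language_block.
pose N k := iword (block k).
have orbitE k z : sqn z <= 1 -> orbit N k z = iword (prefix_of w (k * n)) z.
  move=> z1; elim: k => [|k IH]; first by rewrite mul0n iword0.
  by rewrite prefS iword_cat // /= IH.
have [eps eps1 side] := one_side yC (fun m => refined_open (prefix_of w m))
  (fun m k mk z => eq_ind _ (fun u => refined F W (prefix_of w k) z -> refined F W u z)
    (@refined_take _ m z) _ (take_prefix_of w mk)) cy.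
have c0 : sqn (0 : C) < 1 by rewrite sqn0.
apply: (@center_cvg R N y yC _ (fun t : n.-tuple A => iword t)
  (fun k => Tuple (block_size k)) _ _ eps) => //.
- move=> k; rewrite /N /iword /= oppr_eq0.
  by have [_] := expand (Lblock k) (eqP (block_size k)).
- by move=> k; exact: mob_disc.
- by move=> k; rewrite orbitE ?word_mobK ?ltW //; apply: mob_disc.
- move=> k; have [h _] := expand (Lblock k) (eqP (block_size k)); apply: h.
  rewrite orbitE //; apply: closure_refined_cat; rewrite -prefS; exact: cy.
- move=> k B; have [z hz zB] := side (k.+1 * n)%N B.
  exists z; split => //; first exact: refined_circle hz.
  have [h _] := expand (Lblock k) (eqP (block_size k)); apply: h.
  apply: subset_closure; rewrite orbitE; last first.
    by apply: circle_sqn_le1; exact: refined_circle hz.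
  by move: hz; rewrite prefS => /refined_cat[].
Qed.

(** A prefix of length [r + k * n] is a prefix of length [r] followed by [k]
    blocks of the word shifted by [r].  So [center_blocks] for the shifted word
    and the preimage of [y], followed by the continuity of the first map, gives
    convergence along each residue class modulo [n]. *)
Lemma centers_cvg w y : Sigma w ->
  (forall m, closure (refined F W (prefix_of w m)) y) ->
  forall e : R, 0 < e -> exists K, forall m, (K <= m)%N ->
    sqn (word_mob F (prefix_of w m) 0 - y) < e.
Proof.
move=> Sw cy e e0.
have yC : circle y := closure_refined_circle (cy 0%N).
have y1 := circle_sqn_le1 yC.
have residue r : exists K, forall k, (K <= k)%N ->
    sqn (word_mob F (prefix_of w (r + k * n)) 0 - y) < e.
  pose G := word_mob F (prefix_of w r).
  pose y' := iword (prefix_of w r) y.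
  have y'C : circle y' by exact: mob_circle.
  have Gy : G y' = y by exact: iwordK.
  have /(_ [set z | sqn (z - y) < e]) := @mob_cont R G y' (den_neq0 G (circle_sqn_le1 y'C)).
  have h : nbhs (G y') [set z | sqn (z - y) < e] by rewrite Gy; apply/nbhs_sqnP; exists e.
  move=> /(_ h) /nbhs_sqnP[d d0 hd].
  have Sw' := subshift_tail r interval_shift_subshift Sw.
  have cy' m : closure (refined F W (prefix_of (fun i => w (r + i)%N) m)) y'.
    by apply: closure_refined_cat; rewrite -prefix_ofD; exact: cy.
  have [K hK] := center_blocks Sw' cy' d0.
  exists K => k Kk; rewrite prefix_ofD word_mob_cat; last by rewrite sqn0.
  by apply: hd; exact: hK.
have /(_ n)[K hK] : forall N, exists K, forall r, (r < N)%N -> forall k, (K <= k)%N ->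
    sqn (word_mob F (prefix_of w (r + k * n)) 0 - y) < e.
  elim=> [|r [K IH]]; first by exists 0%N.
  have [K' hK'] := residue r; exists (maxn K K') => s.
  rewrite ltnS leq_eqVlt => /orP[/eqP ->|sr] k; rewrite geq_max => /andP[h1 h2].
    exact: hK'.
  exact: IH.
exists (K * n)%N => m Km.
rewrite (divn_eq m n) addnC; apply: hK; first by rewrite ltn_mod.
by rewrite leq_divRL.
Qed.

Lemma Phi_point w y : Sigma w ->
  (forall m, closure (refined F W (prefix_of w m)) y) ->
  represents (fun m => word_mob F (prefix_of w m)) y /\ Phi F w = y.
Proof.
move=> Sw cy; have yC : circle y := closure_refined_circle (cy 0%N).
have ry : represents (fun m => word_mob F (prefix_of w m)) y.
  by apply: represents_of_center => // e e0; exact: centers_cvg.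
split => //; apply: (represents_unique _ ry).
rewrite /Phi; exact: (xgetPex 0 (ex_intro _ y ry)).
Qed.

Lemma Sigma_point w : Sigma w ->
  exists y, forall m, closure (refined F W (prefix_of w m)) y.
Proof.
move=> [_ hw]; apply: nested_cluster => // [m|m k mk].
  exact: refined_circle.
by rewrite -(take_prefix_of w mk); exact: refined_take.
Qed.

Lemma Phi_closure w : Sigma w ->
  forall m, closure (refined F W (prefix_of w m)) (Phi F w).
Proof. by move=> Sw; have [y cy] := Sigma_point Sw; have [_ ->] := Phi_point Sw cy. Qed.

(** The closed refined sets of the prefixes of [w] intersect in [Phi w] only, by
    [Phi_point]; so one of them lies in a given neighbourhood of [Phi w], and it
    contains the image of a whole cylinder. *)
Lemma Phi_continuous : {within Sigma, continuous (Phi F)}.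
Proof.
rewrite continuous_subspace_in => w /set_mem Sw.
move=> B nB; have {}nB : nbhs (Phi F w) B by [].
suff near_w : \forall w' \near w, Sigma w' -> B (Phi F w').
  by rewrite /nbhs /= -nbhs_subspace_in.
have [m hm] : exists m, closure (refined F W (prefix_of w m)) `<=` B.
  apply: contrapT => /forallNP h.
  have [||m k mk z [hz Bz]|y cy] :=
    @nested_cluster R (fun m => closure (refined F W (prefix_of w m)) `\` B).
  - by move=> m z [/closure_refined_circle].
  - by move=> m; have /existsNP[z /not_implyP[hz Bz]] := h m; exists z.
  - split => //; move: hz; rewrite -(take_prefix_of w mk); exact: closure_refined_take.
  have cy' m : closure (refined F W (prefix_of w m)) y.
    apply: (@closed_closure _ (refined F W (prefix_of w m))).
    by apply: closure_subset (cy m) => z [].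
  have [_ yE] := Phi_point Sw cy'; rewrite yE in nB.
  by have [z [[_ nBz] Bz]] := cy 0%N B nB.
apply: filterS (nbhs_cylinder w m) => w' /cylinder_prefixP e Sw'.
by apply: hm; rewrite -e; exact: Phi_closure.
Qed.

Lemma Phi_cylinder v : language S v ->
  Phi F @` (cylinder v `&` Sigma) = closure (refined F W v).
Proof.
move=> Lv; apply/seteqP; split => [_ [w [vw Sw] <-]|y cy].
  by rewrite -vw; exact: Phi_closure.
have [w Sw [vw cw]] := point_extension Lv cy.
by exists w; [split | have [] := Phi_point Sw cw].
Qed.

Lemma number_system : mobius_number_system F Sigma.
Proof.
split; first exact: interval_shift_subshift.
- move=> w Sw; have [y cy] := Sigma_point Sw; exists y.
  by have [] := Phi_point Sw cy.
- have [[w0 Sw0] _] := comp.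
  have L0 : language S [::] by exists w0 => //; exists 0%N.
  have := Phi_cylinder L0; rewrite refined0.
  have -> : cylinder [::] `&` Sigma = Sigma by apply/seteqP; split => w; [case | split].
  by move=> ->; apply/esym/closure_id; exact: circle_closed.
- exact: Phi_continuous.
Qed.

End Refined.

(** The default value of [set_min] is zero, so a positive value is a genuine
    minimum. *)
Lemma set_min_gt0 (R : realType) (U : set R) : 0 < set_min U ->
  U (set_min U) /\ lbound U (set_min U).
Proof.
rewrite /set_min; have [h|h] := pselect (exists m, U m /\ lbound U m).
  by move=> _; exact: (xgetPex 0 h).
rewrite xgetPN ?ltxx // => m hm; apply: h; by exists m.
Qed.

Lemma bullet_rotation (R : realType) (G : mobius R) x :
  mob_b G = 0 -> circle x -> bullet G x = 1.
Proof.
move=> b0 xC; rewrite bulletE // lam_expand // b0 conjC0 mulr0 mul0r.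
by rewrite sqn0 /= !mulr0 !addr0 invr1.
Qed.

(** The two cases of the hypothesis merge: a rotation has [bullet] equal to 1
    everywhere, which excludes [Qmin > 1] because the refined set of a word of
    the language is nonempty. *)
Lemma Qmin_expand (R : realType) (A : finType) (F : A -> mobius R)
    (W : A -> set (Cplx R)) (S : set (infword A)) n :
  (forall a, rel_open (W a)) -> subshift S ->
  1 < Qmin F n W S \/ (Qmin F n W S = 1 /\
    forall v : seq A, language (interval_shift F W S) v -> size v = n ->
      ~ is_rotation (word_mob F v)) ->
  forall u, language (interval_shift F W S) u -> size u = n ->
  (forall x, closure (refined F W u) x -> lam (iword F u) x <= 1) /\
  mob_b (word_mob F u) != 0.
Proof.
move=> Wo sS hQ u Lu un.
have Q1 : 1 <= Qmin F n W S by case: hQ => [/ltW|[->]].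
have [_ Qlb] := set_min_gt0 (lt_le_trans ltr01 Q1).
have qu : Qmin F n W S <= qmin F W u by apply: Qlb; exists u.
have [_ qlb] := set_min_gt0 (lt_le_trans ltr01 (le_trans Q1 qu)).
have bl x : closure (refined F W u) x -> Qmin F n W S <= (lam (iword F u) x)^-1.
  move=> hx; apply: (le_trans qu); apply: qlb; exists x => //.
  rewrite bulletE //; exact: closure_refined_circle hx.
have l0 x : closure (refined F W u) x -> 0 < lam (iword F u) x.
  by move=> hx; apply: lam_gt0; apply: circle_sqn_le1; exact: closure_refined_circle hx.
split=> [x hx|].
  by rewrite -invf_ge1 ?l0 //; apply: le_trans Q1 (bl x hx).
apply/eqP => b0; case: hQ => [Q2|[_ /(_ u Lu un)]]; last by [].
have [w Sw uE] := (language_prefix _ (interval_shift_subshift F Wo sS)).1 Lu.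
have [z uz] : refined F W u !=set0 by rewrite -uE; exact: Sw.2.
have := bl z (subset_closure uz).
rewrite -bulletE ?bullet_rotation //=; first by rewrite leNgt Q2.
- by rewrite b0 oppr0.
- exact: refined_circle uz.
- exact: refined_circle uz.
Qed.

Theorem corollary28 (R : realType) (A : finType) (F : A -> mobius R)
    (W : A -> set (Cplx R)) (S : set (infword A)) :
  interval_almost_cover W ->
  subshift S ->
  compatible F W S ->
  (exists n : nat, (1 <= n)%N /\
    (1 < Qmin F n W S \/
     (Qmin F n W S = 1 /\
      forall v : seq A, language (interval_shift F W S) v -> size v = n ->
        ~ is_rotation (word_mob F v)))) ->
  mobius_number_system F (interval_shift F W S) /\
  (forall v : seq A, language S v ->
    Phi F @` (cylinder v `&` interval_shift F W S) = closure (refined F W v)).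
Proof.
move=> [hW _] sS comp [n [n1 hQ]].
have Wo a : rel_open (W a) by exact: union_arcs_open.
have expand := Qmin_expand Wo sS hQ.
split=> [|v Lv]; first exact: number_system expand.
exact: Phi_cylinder expand _ Lv.
Qed.
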